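(* Let $d=2$, $p\in\mathbb N$ ($p\ge1$) and $n_{2,p}=(p+1)^2$. Let the parameters $k_m$ and $\theta_{m,\lambda}$ satisfy: - $k_m\in\mathbb R$ for $m=0,\dots,p$, with $k_m\ne0$, and $k_{m_1}^2\ne k_{m_2}^2$ for $m_1\ne m_2$; - $\theta_{m,\lambda}\in[0,2\pi)$ for $m=0,\dots,p$, $\lambda=1,\dots,2m+1$, with $\theta_{m,\lambda_1}\ne\theta_{m,\lambda_2}$ for $\lambda_1\ne\lambda_2$. Let $K=K_{\mathbf x}\times I_n$ be a space–time mesh element on which the real potential $V$ is constant. Define the directions $\mathbf d_{m,\lambda}=(\cos\theta_{m,\lambda},\sin\theta_{m,\lambda})$ and the basis functions $$\phi_{m,\lambda}(\mathbf x,t)=\exp\big[i\big(k_m\mathbf d_{m,\lambda}^\top\mathbf x-(k_m^2+V|_K)t\big)\big],\qquad m=0,\dots,p,\ \lambda=1,\dots,2m+1,$$ of $\mathbb T_p(K)=\mathrm{span}\{\phi_{m,\lambda}\}$. Let $B\subset K$ be a three-dimensional ball such that $K$ is star-shaped with respect to $B$. Then for every $\psi\in\mathbf T(K)\cap H^{p+1}(K)$ there exists a vector-valued function $\mathbf a=(a_{m,\lambda})\in L^1(B)^{(p+1)^2}$ such that $$D^{\boldsymbol j}\psi(\mathbf z,s)=\sum_{m=0}^p\sum_{\lambda=1}^{2m+1}a_{m,\lambda}(\mathbf z,s)\,D^{\boldsymbol j}\phi_{m,\lambda}(\mathbf z,s)\quad\text{for all }|\boldsymbol j|\le p\text{ and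 a.e. }(\mathbf z,s)\in B,$$ and $$\int_B\sum_{m=0}^p\sum_{\lambda=1}^{2m+1}|a_{m,\lambda}(\mathbf z,s)|\,\mathrm dV(\mathbf z,s)\le C_\star\,|K|^{1/2}\,\|\psi\|_{H^{p+1}(K)},$$ where the constant $C_\star>0$ might depend on $p$ and $\{\phi_{m,\lambda}\}$ but is independent of $K$ and $\psi$.
   Context: $K_{\mathbf x}\subset\mathbb R^2$ is a polygonal element of a partition of a bounded Lipschitz domain, $I_n$ is a bounded open time interval, $K=K_{\mathbf x}\times I_n\subset\mathbb R^3$, and $|K|$ is its Lebesgue measure. Functions are complex valued, and $$\mathbf T(K)=\{w\in H^1(I_n;L^2(K_{\mathbf x}))\cap L^2(I_n;H^2(K_{\mathbf x})):\ i\partial_tw+\Delta w-Vw=0\text{ on }K\},$$ with $\Delta$ the Laplacian in $\mathbf x$. $H^{p+1}(K)$ is the space–time Sobolev space on $K$. For $\boldsymbol j=(j_x,j_y,j_t)\in\mathbb N_0^3$, $|\boldsymbol j|=j_x+j_y+j_t$ and $D^{\boldsymbol j}f=\partial_x^{j_x}\partial_y^{j_y}\partial_t^{j_t}f$. The pointwise values $D^{\boldsymbol j}\psi(\mathbf z,s)$, $|\boldsymbol j|\le p$, are those of the order-$p$ differential (Taylor polynomial) at $(\mathbf z,s)$ of an $H^{p+1}(\mathbb R^3)$ extension of $\psi$, which exists for a.e. $(\mathbf z,s)$; they agree a.e. with the weak derivatives of $\psi$. *)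

(* Defs.v *)
From HB Require Import structures.
From mathcomp Require Import all_boot all_order all_algebra.
From mathcomp Require Import all_classical all_reals all_analysis.
From mathcomp Require Import complex.
Set Implicit Arguments.
Unset Strict Implicit.
Unset Printing Implicit Defensive.
Import Order.TTheory GRing.Theory Num.Theory numFieldNormedType.Exports.
Import ComplexField.Normc.
Local Open Scope classical_set_scope.
Local Open Scope ring_scope.
Local Open Scope complex_scope.

(* Points are ((x, y), t). *)
Notation plane R := (R * R)%type.
Notation spacetime R := (R * R * R)%type.

(* The library's instance for products of sigma-finite measures is shadowed by
   the one for subprobabilities; this lemma recovers it, so that the Fubini
   theorems apply to the iterated product leb3. *)
Lemma product_sigma_finite (d1 d2 : measure_display) (T1 : measurableType d1)
    (T2 : measurableType d2) (R : realType)
    (m1 : {sigma_finite_measure set T1 -> \bar R})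
    (m2 : {sigma_finite_measure set T2 -> \bar R}) :
  sigma_finite setT (m1 \x m2)%E.
Proof.
have /sigma_finiteP[F [TF ndF Foo]] := sigma_finiteT m1.
have /sigma_finiteP[G [TG ndG Goo]] := sigma_finiteT m2.
exists (fun n => F n `*` G n).
  rewrite -setXTT TF TG predeqE => -[x y]; split.
    move=> [/= [n _ Fnx] [k _ Gky]]; exists (maxn n k) => //; split.
    - by move: x Fnx; exact/subsetPset/ndF/leq_maxl.
    - by move: y Gky; exact/subsetPset/ndG/leq_maxr.
  by move=> [n _ []/= ? ?]; split; exists n.
move=> k; have [? ?] := Foo k; have [? ?] := Goo k.
split; first exact: measurableX.
by rewrite product_measure1E// lte_mul_pinfty// ge0_fin_numE.
Qed.

Definition leb1 (R : realType) : set (measurableTypeR R) -> \bar R :=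
  lebesgue_measure.
HB.instance Definition _ (R : realType) := SigmaFiniteMeasure.on (@leb1 R).

Definition leb2 (R : realType) :
    set (measurableTypeR R * measurableTypeR R)%type -> \bar R :=
  (@leb1 R \x @leb1 R)%E.
HB.instance Definition _ (R : realType) := Measure.on (@leb2 R).
HB.instance Definition _ (R : realType) :=
  @Measure_isSigmaFinite.Build _ _ _ (@leb2 R) (product_sigma_finite _ _).

Definition leb3 (R : realType) :
    set (measurableTypeR R * measurableTypeR R * measurableTypeR R)%type ->
    \bar R :=
  (@leb2 R \x @leb1 R)%E.
HB.instance Definition _ (R : realType) := Measure.on (@leb3 R).
HB.instance Definition _ (R : realType) :=
  @Measure_isSigmaFinite.Build _ _ _ (@leb3 R) (product_sigma_finite _ _).

Section ComplexFunctions.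
Context (R : realType) (d : measure_display) (T : measurableType d).
Variable mu : {measure set T -> \bar R}.
Implicit Types (D : set T) (f : T -> R[i]).

Definition Cintegral D f : R[i] :=
  (\int[mu]_(x in D) complex.Re (f x)) +i* (\int[mu]_(x in D) complex.Im (f x)).

Definition in_L1 D f : Prop :=
  mu.-integrable D (fun x => (complex.Re (f x))%:E) /\
  mu.-integrable D (fun x => (complex.Im (f x))%:E).

Definition in_L2 D f : Prop :=
  [/\ measurable_fun D (fun x => complex.Re (f x)),
      measurable_fun D (fun x => complex.Im (f x)) &
      (\int[mu]_(x in D) (normc (f x) ^+ 2)%:E < +oo)%E].

End ComplexFunctions.

Section SmoothFunctions.
Context (R : realType) (W : normedModType R).
Implicit Types (f : W -> R) (O : set W) (vs : seq W).

Definition Dseq vs f : W -> R := foldr (fun v g => fun x => 'D_v g x) f vs.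

(* In the finite-dimensional spaces used below this is C^oo. *)
Definition smooth f : Prop :=
  forall vs, continuous (Dseq vs f) /\
             (forall x v, derivable (Dseq vs f) x v).

Definition test_function O f : Prop :=
  smooth f /\
  exists C : set W, [/\ compact C, C `<=` O & forall x, ~ C x -> f x = 0].

End SmoothFunctions.

Section Geometry.
Context (R : realType).

Definition closed_segment (W : lmodType R) (a b : W) : set W :=
  [set (1 - t) *: a + t *: b | t in `[0, 1]].

(* Slits and holes are not excluded here; they are ruled out as soon as the
   element is star-shaped with respect to a ball. *)
Definition is_polygon (P : set (plane R)) : Prop :=
  [/\ open P, P !=set0, connected P, bounded_set P &
      exists edges : seq (plane R * plane R),
        closure P `\` P = \bigcup_(e in [set` edges]) closed_segment e.1 e.2].

(* The norm of the library on products is the sup norm. *)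
Definition euclidean_ball (c : spacetime R) (r : R) : set (spacetime R) :=
  [set z | (z.1.1 - c.1.1) ^+ 2 + (z.1.2 - c.1.2) ^+ 2 + (z.2 - c.2) ^+ 2
           < r ^+ 2].

Definition star_shaped (K B : set (spacetime R)) : Prop :=
  forall y z, B y -> K z -> closed_segment y z `<=` K.

End Geometry.

Definition multi_index := (nat * nat * nat)%type.
Definition mi_order (j : multi_index) : nat := (j.1.1 + j.1.2 + j.2)%N.

Section Sobolev.
Context (R : realType).
Implicit Types (j : multi_index) (K : set (spacetime R)).
Implicit Types (f g : spacetime R -> R[i]).

Definition Dmi j (u : spacetime R -> R) : spacetime R -> R :=
  @Dseq R (spacetime R)
    (nseq j.1.1 (1, 0, 0) ++ nseq j.1.2 (0, 1, 0) ++ nseq j.2 (0, 0, 1)) u.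

Definition CDmi j f (z : spacetime R) : R[i] :=
  Dmi j (fun y => complex.Re (f y)) z +i* Dmi j (fun y => complex.Im (f y)) z.

(* Real-valued test functions suffice, by linearity. *)
Definition is_weak_derivative K j f g : Prop :=
  in_L2 (@leb3 R) K g /\
  forall phi : spacetime R -> R, @test_function R (spacetime R) K phi ->
    Cintegral (@leb3 R) K (fun z => f z * (Dmi j phi z)%:C) =
    (-1) ^+ mi_order j * Cintegral (@leb3 R) K (fun z => g z * (phi z)%:C).

(* A representative of the weak derivative D^j f, which is unique up to null
   sets. For f in H^(p+1) and |j| <= p it agrees almost everywhere with the
   coefficient of the order-p Taylor polynomial of an extension of f. *)
Definition weakD K j f : spacetime R -> R[i] :=
  xget (fun=> 0) [set g | is_weak_derivative K j f g].

Definition in_sobolev (k : nat) K f : Prop :=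
  in_L2 (@leb3 R) K f /\
  forall j, (mi_order j <= k)%N -> exists g, is_weak_derivative K j f g.

Definition sobolev_norm (k : nat) K f : R :=
  Num.sqrt (\sum_(jx < k.+1) \sum_(jy < k.+1)
    \sum_(jt < k.+1 | (mi_order ((jx : nat, jy : nat), jt : nat) <= k)%N)
      \int[@leb3 R]_(z in K)
        (normc (weakD K ((jx : nat, jy : nat), jt : nat) f z) ^+ 2)).

End Sobolev.

Section Bochner.
Context (R : realType) (P : set (plane R)) (I : set R).
Implicit Types (f g : spacetime R -> R[i]).

Definition Dspace (al : nat * nat) (u : plane R -> R) : plane R -> R :=
  @Dseq R (plane R) (nseq al.1 (1, 0) ++ nseq al.2 (0, 1)) u.

Definition is_weak_derivative_space (al : nat * nat)
    (f g : plane R -> R[i]) : Prop :=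
  in_L2 (@leb2 R) P g /\
  forall eta : plane R -> R, @test_function R (plane R) P eta ->
    Cintegral (@leb2 R) P (fun x => f x * (Dspace al eta x)%:C) =
    (-1) ^+ (al.1 + al.2)%N * Cintegral (@leb2 R) P (fun x => g x * (eta x)%:C).

(* g is the derivative of t |-> f(., t) in the sense of distributions on I
   with values in L^2(P): the defining identity of L^2(P)-valued integrals is
   written for almost every x in P. *)
Definition bochner_dt f g : Prop :=
  in_L2 (@leb3 R) (P `*` I) g /\
  forall phi : R -> R, @test_function R R I phi ->
    {ae @leb2 R, forall x, P x ->
      Cintegral (@leb1 R) I (fun t => f (x, t) * (derive1 phi t)%:C) =
      - Cintegral (@leb1 R) I (fun t => g (x, t) * (phi t)%:C)}.

Definition bochner_dx (al : nat * nat) f g : Prop :=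
  in_L2 (@leb3 R) (P `*` I) g /\
  {ae @leb1 R, forall t, I t ->
    is_weak_derivative_space al (fun x => f (x, t)) (fun x => g (x, t))}.

Definition in_H1_L2 f : Prop :=
  in_L2 (@leb3 R) (P `*` I) f /\ exists g, bochner_dt f g.

Definition in_L2_H2 f : Prop :=
  in_L2 (@leb3 R) (P `*` I) f /\
  forall al : nat * nat, (al.1 + al.2 <= 2)%N -> exists g, bochner_dx al f g.

Definition trefftz_space (V : spacetime R -> R) f : Prop :=
  [/\ in_H1_L2 f, in_L2_H2 f &
      exists ft fxx fyy,
        [/\ bochner_dt f ft, bochner_dx (2, 0)%N f fxx,
            bochner_dx (0, 2)%N f fyy &
            {ae @leb3 R, forall z, (P `*` I) z ->
              'i%C * ft z + (fxx z + fyy z) - (V z)%:C * f z = 0}]].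

End Bochner.

Section PlaneWaves.
Context (R : realType).

Definition expC (w : R[i]) : R[i] :=
  (expR (complex.Re w))%:C * (cos (complex.Im w) +i* sin (complex.Im w)).

Definition plane_wave (k theta v : R) (z : spacetime R) : R[i] :=
  expC ('i%C * (k * (cos theta * z.1.1 + sin theta * z.1.2)
              - (k ^+ 2 + v) * z.2)%:C).

End PlaneWaves.

(* Main.v *)
Require Import Defs.
From HB Require Import structures.
From mathcomp Require Import all_boot all_order all_algebra.
From mathcomp Require Import all_classical all_reals all_analysis.
From mathcomp Require Import complex measurable_realfun.
From mathcomp Require Import ring lra zify.
Import Order.TTheory GRing.Theory Num.Theory numFieldNormedType.Exports.
Import ComplexField.Normc.
Set Implicit Arguments.
Unset Strict Implicit.
Unset Printing Implicit Defensive.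
Local Open Scope classical_set_scope.
Local Open Scope ring_scope.
Local Open Scope complex_scope.

(** Why the theorem holds.  At almost every point the derivatives of order at
    most p of a solution form a jet (c_j), and differentiating the equation
    i dt psi + Laplacian psi - v psi = 0 gives
      i c_(j+e_t) + c_(j+2e_x) + c_(j+2e_y) - v c_j = 0   for |j| <= p - 2.
    Such a jet is determined by its entries with j_x <= 1, and there are
    (p + 1)^2 of these.  The jets of the (p + 1)^2 plane waves satisfy the same
    relations; at any point they are the products X^jx Y^jy S^jt of the symbols
      X = i k cos theta,   Y = i k sin theta,   S = - i (k^2 + v)
    multiplied by the value of the wave, which has modulus one.  Hence, if the
    square matrix of the products with j_x <= 1 is invertible, each jet of psi is
    a combination of the jets of the waves, and the coefficients are a fixed
    constant matrix applied to the derivatives of psi, divided by the waves.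
    This gives the bound as well: the integral over the ball of one derivative
    is at most |K|^(1/2) times its L^2 norm by the Cauchy-Schwarz inequality,
    and the matrix depends only on k, theta and v.

    Two facts carry the proof.

    Invertibility (jet_injective, jet_dual).  A vector b in the kernel
    annihilates every polynomial of degree at most p in the symbols, because
    X^2 + Y^2 = v - i S lowers the power of X.  In particular it annihilates
    (X + iY)^n q(k^2) and (X - iY)^n q(k^2) for n + deg q <= p, where
    X + iY and X - iY are i k exp(i theta) and i k exp(- i theta).  Choosing q so
    that it vanishes at all but one of the relevant k_m^2 shows, by induction
    on m, that the 2m + 1 trigonometric moments of b_m of order at most m are
    zero; as there are 2m + 1 distinct angles at level m, b_m = 0.

    The relations between the weak derivatives (weakD_schroedinger).  The
    equation is known for a time derivative taken in L^2 of space and for space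
    derivatives taken at almost every time.  Both can be tested with products
    a(x) b(y) c(t) and Fubini's theorem, also after the products have been
    replaced by their derivatives.  So the combination of weak derivatives in
    the relation is orthogonal to all these products.  Products increase to the
    indicators of boxes, so its integral over every box in K vanishes, and by
    the monotone class theorem it vanishes almost everywhere
    (fundamental_lemma). *)

(** * Smooth functions of compact support *)

Section FlatFunctions.
Context {R : realType}.
Implicit Types (n : nat) (x : R).

(** The building block of all test functions is exp (- 1/x) on the positive
    half-line; the powers of 1/x make the family stable under differentiation. *)
Definition flat n x : R := if 0 < x then x^-1 ^+ n * expR (- x^-1) else 0.

Lemma flat_ge0 n x : 0 <= flat n x.
Proof.
rewrite /flat; case: ifP => // x0.
by rewrite mulr_ge0 ?expR_ge0// exprn_ge0// invr_ge0 ltW.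
Qed.

Lemma flat_gt0 n x : 0 < x -> 0 < flat n x.
Proof. by move=> x0; rewrite /flat x0 mulr_gt0 ?expR_gt0// exprn_gt0// invr_gt0. Qed.

Lemma flat_eq0 n x : x <= 0 -> flat n x = 0.
Proof. by rewrite /flat ltNge => ->. Qed.

(** With y = 1/x this is y^m <= m! exp y, a term of the exponential series. *)
Lemma flat_le n x : flat n.+1 x <= n.+1`!%:R.
Proof.
rewrite /flat; case: ifP => [x0|_]; last by rewrite ler0n.
have y0 : 0 < x^-1 by rewrite invr_gt0.
rewrite expRN ler_pdivrMr ?expR_gt0// mulrC -ler_pdivrMr ?ltr0n ?fact_gt0//.
by apply: le_trans (expR_ge1Dxn n (ltW y0)); rewrite lerDr ler01.
Qed.

Lemma flat0_le1 x : flat 0 x <= 1.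
Proof.
rewrite /flat; case: ifP => [x0|_]; last by rewrite ler01.
by rewrite expr0 mul1r -expR0 ler_expR oppr_le0 invr_ge0 ltW.
Qed.

Lemma is_derive_flat n x :
  is_derive x 1 (flat n) (flat n.+2 x - n%:R * flat n.+1 x).
Proof.
have [x0|x0|->] := ltgtP x 0.
- rewrite !flat_eq0 ?(ltW x0)// mulr0 subr0.
  apply: (@near_eq_is_derive _ R R (cst 0)).
  near=> y; rewrite flat_eq0//; apply: ltW; near: y; exact: lt_nbhsl.
- have xn0 : x != 0 by rewrite gt_eqF.
  apply: (@near_eq_is_derive _ R R (fun y => (y^-1) ^+ n * expR (- y^-1))).
    near=> y; rewrite /flat ifT//; near: y; exact: lt_nbhsr.
  have dV : is_derive x 1 (fun y : R => y^-1) (- x ^- 2).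
    by apply: is_derive_eq; [exact: is_deriveV|rewrite /GRing.scale/= mulr1].
  have dE : is_derive x 1 (fun y : R => expR (- y^-1))
      (expR (- x^-1) * (x ^- 2)).
    apply: (@is_derive1_comp _ expR).
    by rewrite -[X in is_derive _ _ _ X]opprK; exact: is_deriveN.
  have dX := is_deriveX n dV.
  rewrite (_ : (fun y => _) = (GRing.inv ^+ n) * (fun y : R => expR (- y^-1))); last first.
    by apply/funext => y; rewrite mulrfctE exprfctE.
  apply: (is_derive_eq (is_deriveM dX dE)).
  rewrite /flat x0 /GRing.scale/= exprfctE ![in X in _ = X]exprS.
  by case: n {dX} => [|n] /=; rewrite ?exprS; field; exact: xn0.
(* At the origin flat n h = h^2 flat (n + 2) h and flat (n + 2) is bounded, so
   that the difference quotient is O(h). *)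
- rewrite !flat_eq0// mulr0 subr0.
  have h0 : (fun h : R => h^-1 *: (flat n (h *: 1 + 0) - flat n 0)) @ 0^' --> (0:R).
    apply/cvgr0Pnorm_le => e e0; near=> h.
    rewrite (flat_eq0 _ (lexx 0)) subr0 addr0 /GRing.scale/= mulr1 normrM normfV.
    have [h0|h0] := ltP 0 h; last by rewrite flat_eq0// normr0 mulr0 ltW.
    have -> : flat n h = h ^+ 2 * flat n.+2 h.
      by rewrite /flat h0 !exprS; field; rewrite gt_eqF.
    rewrite normrM (ger0_norm (flat_ge0 _ _)) (ger0_norm (ltW h0)).
    rewrite (ger0_norm (exprn_ge0 _ (ltW h0))).
    have -> : h^-1 * (h ^+ 2 * flat n.+2 h) = h * flat n.+2 h by field; rewrite gt_eqF.
    apply: (@le_trans _ _ (h * n.+2`!%:R)).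
      by rewrite ler_pM2l// flat_le.
    rewrite -ler_pdivlMr ?ltr0n ?fact_gt0//.
    rewrite -[leLHS](ger0_norm (ltW h0)).
    apply: ltW. near: h; apply: dnbhs0_lt.
    by rewrite divr_gt0// ltr0n fact_gt0.
  apply: DeriveDef; first by apply/cvg_ex; exists 0.
  exact: cvg_lim h0.
Unshelve. all: by end_near. Qed.

End FlatFunctions.

Section SmoothClass.
Context {R : realType} {W : normedModType R}.
Implicit Types (f g : W -> R).

(** Smoothness asks for all iterated derivatives in all directions.  A class
    given by generators contains the functions needed here, and it is enough to
    see that one derivative stays in the class. *)
Inductive smooth_class : (W -> R) -> Prop :=
| Smooth_cst c : smooth_class (cst c)
| Smooth_flat n (L : {linear W -> R}) c : continuous L ->
    smooth_class (fun z => flat n (L z + c))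
| Smooth_add f g : smooth_class f -> smooth_class g ->
    smooth_class (f + g)
| Smooth_mul f g : smooth_class f -> smooth_class g ->
    smooth_class (f * g).

Lemma differentiable_flat n (x : R) : differentiable (flat n) x.
Proof. by apply/derivable1_diffP; have [] := is_derive_flat n x. Qed.

Lemma is_diff_affine (L : {linear W -> R}) c (x : W) : continuous L ->
  is_diff x (fun z => L z + c) L.
Proof.
move=> cL.
have dL : is_diff x L L by apply: DiffDef; [exact: linear_differentiable|exact: diff_lin].
by have := is_diffD dL (is_diff_cst c x); rewrite addr0.
Qed.

Lemma derive_comp_diff (h : R -> R) (A dA : W -> R) x v :
  is_diff x A dA -> differentiable h (A x) ->
  'D_v (fun z => h (A z)) x = dA v * derive1 h (A x).
Proof.
move=> [dfA <-] dh; rewrite -[LHS]/('D_v (h \o A) x).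
rewrite (deriveE _ (differentiable_comp dfA dh)).
rewrite [LHS](congr1 (@^~ v) (diff_comp dfA dh)).
exact: (congr1 (@^~ ('d A x v)) (diff1E dh)).
Qed.

Lemma smooth_class_differentiable f x : smooth_class f -> differentiable f x.
Proof.
elim=> [c|n L c cL|{}f g _ df _ dg|{}f g _ df _ dg].
- exact: differentiable_cst.
- apply: (@differentiable_comp _ _ _ _ (fun z => L z + c) (flat n)).
    by have [] := is_diff_affine c x cL.
  exact: differentiable_flat.
- exact: differentiableD.
- exact: differentiableM.
Qed.

Lemma smooth_class_derive f v : smooth_class f -> smooth_class (fun x => 'D_v f x).
Proof.
elim=> [c|n L c cL|{}f g sf df sg dg|{}f g sf df sg dg].
- have -> : (fun x => 'D_v (cst c) x) = cst (0:R) by apply/funext => x; exact: derive_cst.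
  exact: Smooth_cst.
- have -> : (fun x => 'D_v (fun z => flat n (L z + c)) x) =
      cst (L v) * ((fun z => flat n.+2 (L z + c)) +
                   cst (- n%:R) * (fun z => flat n.+1 (L z + c))).
    apply/funext => x.
    rewrite (derive_comp_diff _ (is_diff_affine c x cL) (differentiable_flat _ _)).
    rewrite derive1E.
    have [_ ->] := is_derive_flat n (L x + c).
    by rewrite /GRing.mul/=/GRing.mul/= /GRing.add /= mulNr.
  apply: Smooth_mul; first exact: Smooth_cst.
  apply: Smooth_add; first exact: Smooth_flat.
  by apply: Smooth_mul; [exact: Smooth_cst|exact: Smooth_flat].
- have -> : (fun x => 'D_v (f + g) x) = (fun x => 'D_v f x) + (fun x => 'D_v g x).
    apply/funext => x; rewrite deriveD//;
    by apply: diff_derivable; exact: smooth_class_differentiable.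
  exact: Smooth_add.
- have -> : (fun x => 'D_v (f * g) x) = f * (fun x => 'D_v g x) + g * (fun x => 'D_v f x).
    apply/funext => x; rewrite deriveM//;
    by apply: diff_derivable; exact: smooth_class_differentiable.
  by apply: Smooth_add; exact: Smooth_mul.
Qed.

Lemma smooth_class_smooth f : smooth_class f -> smooth f.
Proof.
move=> sf vs.
have s1 : smooth_class (Dseq vs f).
  by elim: vs => //= v vs; exact: smooth_class_derive.
split=> x.
  exact/differentiable_continuous/smooth_class_differentiable.
by move=> v; exact/diff_derivable/smooth_class_differentiable.
Qed.

End SmoothClass.

Lemma smooth_class_comp (R : realType) (W W' : normedModType R)
    (L : {linear W' -> W}) (f : W -> R) :
  continuous L -> smooth_class f -> smooth_class (f \o L).
Proof.
move=> cL; elim=> [c|n M c cM|{}f g _ sf _ sg|{}f g _ sf _ sg].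
- exact: (@Smooth_cst R W' c).
- apply: (@Smooth_flat _ _ n (M \o L : {linear _ -> _}) c) => x.
  exact: (continuous_comp (cL x) (cM _)).
- exact: Smooth_add sf sg.
- exact: Smooth_mul sf sg.
Qed.

Section Bumps.
Context {R : realType}.
Implicit Types (a b : R -> R) (l u : R).

Definition bump l u a : Prop :=
  smooth_class a /\ forall x, (x < l) || (u < x) -> a x = 0.

Lemma bump_derive1 l u a : bump l u a -> bump l u (derive1 a).
Proof.
move=> [sa a0]; split.
  rewrite (_ : (derive1 a) = (fun x => 'D_1 a x)); first exact: smooth_class_derive.
  by apply/funext => x; rewrite derive1E.
move=> x xlu; rewrite derive1E.
rewrite -(@near_eq_derive _ R R (cst 0)) ?derive_cst//.
move: xlu => /orP[xl|ux].
  near=> y; rewrite a0//; apply/orP; left; near: y; exact: lt_nbhsl.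
near=> y; rewrite a0//; apply/orP; right; near: y; exact: lt_nbhsr.
Unshelve. all: by end_near. Qed.

Lemma bump_derive1n l u a n : bump l u a -> bump l u (derive1n n a).
Proof. by move=> ba; elim: n => //= n IH; exact: bump_derive1. Qed.

Lemma bump_differentiable l u a x : bump l u a -> differentiable a x.
Proof. by move=> [sa _]; exact: smooth_class_differentiable. Qed.

Lemma bump_continuous l u a : bump l u a -> continuous a.
Proof. by move=> ba x; apply: differentiable_continuous; exact: bump_differentiable ba. Qed.

(** A smooth function with values in [0, 1] that is positive exactly on
    ]l, u[. *)
Definition pre_bump l u : R -> R := fun x => flat 0 (x - l) * flat 0 (u - x).

(** These increase to the indicator of ]l, u[, and they are polynomials in
    pre_bump, hence in the class of smooth functions. *)
Definition cutoff l u n : R -> R := fun x => 1 - (1 - pre_bump l u x) ^+ n.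

Lemma smooth_class_pre_bump l u : smooth_class (pre_bump l u).
Proof.
apply: Smooth_mul.
  by apply: (@Smooth_flat _ _ 0 idfun (- l)) => x; exact: cvg_id.
rewrite (_ : (fun x => _) = (fun x => flat 0 (- idfun x + u))).
  by apply: (@Smooth_flat _ _ 0 (\- idfun) u) => x; apply: continuousN.
by apply/funext => x; rewrite addrC.
Qed.

Lemma pre_bump_eq0 l u x : (x <= l) || (u <= x) -> pre_bump l u x = 0.
Proof.
rewrite /pre_bump => /orP[h|h].
  by rewrite [flat 0 (x - l)]flat_eq0 ?mul0r ?subr_le0.
by rewrite [flat 0 (u - x)]flat_eq0 ?mulr0 ?subr_le0.
Qed.

Lemma pre_bump_gt0 l u x : l < x < u -> 0 < pre_bump l u x.
Proof. by move=> /andP[? ?]; rewrite mulr_gt0// flat_gt0// subr_gt0. Qed.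

Lemma pre_bump01 l u x : 0 <= pre_bump l u x <= 1.
Proof. by rewrite /pre_bump mulr_ge0 ?flat_ge0//= mulr_ile1 ?flat_ge0 ?flat0_le1. Qed.

Lemma bump_cutoff l u n : bump l u (cutoff l u n).
Proof.
split.
  apply: (@Smooth_add _ _ (cst 1) (fun x => - (1 - pre_bump l u x) ^+ n)).
    exact: Smooth_cst.
  rewrite (_ : (fun x => _) = cst (-1) * (fun x => (1 - pre_bump l u x) ^+ n)); last first.
    by apply/funext => x; rewrite mulrfctE mulN1r.
  apply: Smooth_mul; first exact: Smooth_cst.
  elim: n => [|n IH].
    rewrite (_ : (fun x => _) = cst 1); first exact: Smooth_cst.
    by apply/funext => x; rewrite expr0.
  rewrite (_ : (fun x => _) = (cst 1 + cst (-1) * pre_bump l u) *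
      (fun x => (1 - pre_bump l u x) ^+ n)); last first.
    by apply/funext => x; rewrite exprS mulrfctE /= addrfctE /= mulrfctE mulN1r.
  apply: Smooth_mul => //; apply: Smooth_add; first exact: Smooth_cst.
  by apply: Smooth_mul; [exact: Smooth_cst|exact: smooth_class_pre_bump].
move=> x xlu; rewrite /cutoff pre_bump_eq0 ?subr0 ?expr1n ?subrr//.
by case/orP: xlu => /ltW ->; rewrite ?orbT.
Qed.

Lemma cutoff01 l u n x : 0 <= cutoff l u n x <= 1.
Proof.
have /andP[h0 h1] := pre_bump01 l u x.
rewrite /cutoff subr_ge0 gerBl exprn_ile1 ?exprn_ge0 ?subr_ge0//.
by rewrite gerBl.
Qed.

Lemma cvg_cutoff l u x : cutoff l u n x @[n --> \oo] --> (\1_(`]l, u[%classic) x : R).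
Proof.
have [xlu|xlu] := boolP (l < x < u).
  rewrite indicE mem_set//=.
  rewrite -[X in _ --> X]subr0; apply: cvgB; first exact: cvg_cst.
  apply: cvg_expr; have /andP[h0 h1] := pre_bump01 l u x.
  by rewrite ger0_norm ?subr_ge0// gtrBl pre_bump_gt0.
rewrite indicE memNset/=; last by rewrite in_itv/=; exact/negP.
rewrite /cutoff pre_bump_eq0; last first.
  by move: xlu; rewrite negb_and -!leNgt.
by under eq_fun do rewrite subr0 expr1n subrr; exact: cvg_cst.
Qed.

End Bumps.

(** * Test functions of product form *)

Section Tensors.
Context {R : realType}.
Implicit Types (a b c : R -> R) (l u : R).

Definition tensor2 a b : plane R -> R := fun x => a x.1 * b x.2.

Definition tensor3 a b c : spacetime R -> R :=
  fun z => a z.1.1 * b z.1.2 * c z.2.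

Lemma is_diff_linear (W : normedModType R) (L : {linear W -> R}) x :
  continuous L -> is_diff x L L.
Proof.
by move=> cL; apply: DiffDef; [exact: linear_differentiable|exact: diff_lin].
Qed.

Let plane_x : {linear plane R -> R} := fst.
Let plane_y : {linear plane R -> R} := snd.

Let plane_x_cont : continuous plane_x. Proof. by move=> x; exact: cvg_fst. Qed.
Let plane_y_cont : continuous plane_y. Proof. by move=> x; exact: cvg_snd. Qed.

Definition coord_x : {linear spacetime R -> R} := fst \o fst.
Definition coord_y : {linear spacetime R -> R} := snd \o fst.
Definition coord_t : {linear spacetime R -> R} := snd.

Lemma coord_x_continuous : continuous coord_x.
Proof. by move=> z; apply: continuous_comp; exact: cvg_fst. Qed.

Lemma coord_y_continuous : continuous coord_y.
Proof.
by move=> z; apply: continuous_comp; [exact: cvg_fst|exact: cvg_snd].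
Qed.

Lemma coord_t_continuous : continuous coord_t.
Proof. by move=> z; exact: cvg_snd. Qed.

Lemma smooth_class_tensor2 a b : smooth_class a -> smooth_class b ->
  smooth_class (tensor2 a b).
Proof.
move=> sa sb; apply: (@Smooth_mul _ _ (a \o plane_x) (b \o plane_y)).
  exact: smooth_class_comp plane_x_cont sa.
exact: smooth_class_comp plane_y_cont sb.
Qed.

Lemma smooth_class_tensor3 a b c : smooth_class a -> smooth_class b ->
  smooth_class c -> smooth_class (tensor3 a b c).
Proof.
move=> sa sb sc.
apply: (@Smooth_mul _ _ ((a \o coord_x) * (b \o coord_y)) (c \o coord_t)).
  apply: Smooth_mul; first exact: smooth_class_comp coord_x_continuous sa.
  exact: smooth_class_comp coord_y_continuous sb.
exact: smooth_class_comp coord_t_continuous sc.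
Qed.

Lemma derive_tensor2 a b v x : smooth_class a -> smooth_class b ->
  'D_v (tensor2 a b) x =
    v.1 * tensor2 (derive1 a) b x + v.2 * tensor2 a (derive1 b) x.
Proof.
move=> sa sb.
have := smooth_class_comp plane_x_cont sa.
have := smooth_class_comp plane_y_cont sb.
move=> sb' sa'.
rewrite -[tensor2 a b]/((a \o plane_x) * (b \o plane_y)).
rewrite deriveM; [|exact/diff_derivable/smooth_class_differentiable..].
rewrite (derive_comp_diff v (is_diff_linear x plane_x_cont)
  (smooth_class_differentiable _ sa)).
rewrite (derive_comp_diff v (is_diff_linear x plane_y_cont)
  (smooth_class_differentiable _ sb)).
by rewrite /tensor2 /GRing.scale/=; ring.
Qed.

Lemma derive_tensor3 a b c v z :
  smooth_class a -> smooth_class b -> smooth_class c ->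
  'D_v (tensor3 a b c) z =
    v.1.1 * tensor3 (derive1 a) b c z + v.1.2 * tensor3 a (derive1 b) c z +
    v.2 * tensor3 a b (derive1 c) z.
Proof.
move=> sa sb sc.
have sa' := smooth_class_comp coord_x_continuous sa.
have sb' := smooth_class_comp coord_y_continuous sb.
have sc' := smooth_class_comp coord_t_continuous sc.
rewrite -[tensor3 a b c]/((a \o coord_x) * (b \o coord_y) * (c \o coord_t)).
have dab : derivable ((a \o coord_x) * (b \o coord_y)) z v.
  by apply/diff_derivable/smooth_class_differentiable; exact: Smooth_mul.
rewrite deriveM//; last exact/diff_derivable/smooth_class_differentiable.
rewrite deriveM; [|exact/diff_derivable/smooth_class_differentiable..].
rewrite (derive_comp_diff v (is_diff_linear z coord_x_continuous)
  (smooth_class_differentiable _ sa)).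
rewrite (derive_comp_diff v (is_diff_linear z coord_y_continuous)
  (smooth_class_differentiable _ sb)).
rewrite (derive_comp_diff v (is_diff_linear z coord_t_continuous)
  (smooth_class_differentiable _ sc)).
by rewrite /tensor3 /GRing.scale/= mulrfctE /=; ring.
Qed.

Lemma smooth_class_derive1n a n : smooth_class a -> smooth_class (derive1n n a).
Proof.
move=> sa; elim: n => //= n IH.
rewrite (_ : derive1 _ = (fun x => 'D_1 (derive1n n a) x)); first exact: smooth_class_derive.
by apply/funext => x; rewrite derive1E.
Qed.

Lemma Dmi_tensor3 (j : multi_index) a b c :
  smooth_class a -> smooth_class b -> smooth_class c ->
  Dmi j (tensor3 a b c) =
    tensor3 (derive1n j.1.1 a) (derive1n j.1.2 b) (derive1n j.2 c).
Proof.
case: j => -[jx jy] jt sa sb sc; rewrite /Dmi/= /Dseq !foldr_cat.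
have -> : foldr (fun v g => fun x => 'D_v g x) (tensor3 a b c)
    (nseq jt (0, 0, 1)) = tensor3 a b (derive1n jt c).
  elim: jt => //= n ->; apply/funext => z.
  have := smooth_class_derive1n n sc => sc'.
  by rewrite derive_tensor3//= !mul0r mul1r !add0r.
have sc' := smooth_class_derive1n jt sc.
have -> : foldr (fun v g => fun x => 'D_v g x) (tensor3 a b (derive1n jt c))
    (nseq jy (0, 1, 0)) = tensor3 a (derive1n jy b) (derive1n jt c).
  elim: jy => //= n ->; apply/funext => z.
  have := smooth_class_derive1n n sb => sb'.
  by rewrite derive_tensor3//= !mul0r mul1r add0r addr0.
have sb' := smooth_class_derive1n jy sb.
elim: jx => //= n ->; apply/funext => z.
have := smooth_class_derive1n n sa => sa'.
by rewrite derive_tensor3//= !mul0r mul1r !addr0.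
Qed.

Lemma Dspace_tensor2 (al : nat * nat) a b :
  smooth_class a -> smooth_class b ->
  Dspace al (tensor2 a b) = tensor2 (derive1n al.1 a) (derive1n al.2 b).
Proof.
case: al => jx jy sa sb; rewrite /Dspace/= /Dseq foldr_cat.
have -> : foldr (fun v g => fun x => 'D_v g x) (tensor2 a b)
    (nseq jy (0, 1)) = tensor2 a (derive1n jy b).
  elim: jy => //= n ->; apply/funext => z.
  have := smooth_class_derive1n n sb => sb'.
  by rewrite derive_tensor2//= !mul0r mul1r add0r.
have sb' := smooth_class_derive1n jy sb.
elim: jx => //= n ->; apply/funext => z.
have := smooth_class_derive1n n sa => sa'.
by rewrite derive_tensor2//= !mul0r mul1r !addr0.
Qed.

Let outside l u x : ~ `[l, u]%classic x -> (x < l) || (u < x).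
Proof. by move=> /negP; rewrite in_itv/= negb_and -!ltNge. Qed.

Lemma test_function_bump l u a (I : set R) : bump l u a ->
  `[l, u]%classic `<=` I -> @test_function R R I a.
Proof.
move=> [sa a0] lI; split; first exact: smooth_class_smooth.
exists `[l, u]%classic; split=> //; first exact: segment_compact.
by move=> x /outside; exact: a0.
Qed.

Lemma test_function_tensor2 l1 u1 l2 u2 a b (P : set (plane R)) :
  bump l1 u1 a -> bump l2 u2 b ->
  `[l1, u1]%classic `*` `[l2, u2]%classic `<=` P ->
  @test_function R (plane R) P (tensor2 a b).
Proof.
move=> [sa a0] [sb b0] lP; split.
  exact/smooth_class_smooth/smooth_class_tensor2.
exists (`[l1, u1]%classic `*` `[l2, u2]%classic); split=> //.
  by apply: compact_setX; exact: segment_compact.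
move=> x /not_andP[] /outside h; rewrite /tensor2.
  by rewrite a0// mul0r.
by rewrite b0// mulr0.
Qed.

Lemma test_function_tensor3 l1 u1 l2 u2 l3 u3 a b c (K : set (spacetime R)) :
  bump l1 u1 a -> bump l2 u2 b -> bump l3 u3 c ->
  `[l1, u1]%classic `*` `[l2, u2]%classic `*` `[l3, u3]%classic `<=` K ->
  @test_function R (spacetime R) K (tensor3 a b c).
Proof.
move=> [sa a0] [sb b0] [sc c0] lK; split.
  exact/smooth_class_smooth/smooth_class_tensor3.
exists (`[l1, u1]%classic `*` `[l2, u2]%classic `*` `[l3, u3]%classic); split=> //.
  apply: compact_setX; last exact: segment_compact.
  by apply: compact_setX; exact: segment_compact.
move=> z /not_andP[/not_andP[]|] /outside h; rewrite /tensor3.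
- by rewrite a0// !mul0r.
- by rewrite b0// mulr0 mul0r.
- by rewrite c0// mulr0.
Qed.

End Tensors.

(** * Signed measures that vanish on boxes *)

Section IntegralDynkin.
Local Open Scope ereal_scope.
Context d d' (T : measurableType d) (T' : measurableType d') (R : realType).
Variables (mu : {measure set T -> \bar R}) (f : T -> T').

(** The sets on which the signed measure h mu vanishes are closed under
    complements and countable disjoint unions.  The map f lets the theorem act
    on one coordinate while S freezes the conditions on the others. *)
Lemma integral_dynkin (G : set (set T')) (S : set T) (h : T -> \bar R) :
  @measurable _ T' = <<s G >> -> setI_closed G ->
  measurable_fun setT f -> measurable S -> mu.-integrable S h ->
  \int[mu]_(z in S) h z = 0 ->
  (forall A, G A -> \int[mu]_(z in S `&` f @^-1` A) h z = 0) ->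
  forall A, measurable A -> \int[mu]_(z in S `&` f @^-1` A) h z = 0.
Proof.
move=> GE GI mf mS ih S0 G0 A.
have mpre B : measurable B -> measurable (S `&` f @^-1` B).
  by move=> mB; apply: measurableI => //; rewrite -[X in measurable X]setTI; exact: mf.
have ihS B : measurable B -> mu.-integrable (S `&` f @^-1` B) h.
  by move=> mB; apply: (integrableS mS) => //; exact: mpre.
rewrite {1}GE => mA.
apply: (@dynkin_induction _ T' G (fun A => \int[mu]_(z in S `&` f @^-1` A) h z = 0)) => //.
- by rewrite preimage_setT setIT.
- move=> B mB B0.
  have : \int[mu]_(z in (S `&` f @^-1` B) `|` (S `&` f @^-1` (~` B))) h z = 0.
    by rewrite -setIUr -preimage_setU setUv preimage_setT setIT.
  rewrite integral_setU//.
  + by rewrite B0 add0e.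
  + exact: mpre.
  + by apply: mpre; exact: measurableC.
  + rewrite -setIUr -preimage_setU setUv preimage_setT setIT.
    by have /integrableP[] := ih.
  + by rewrite disj_set2E preimage_setC setIACA setICr setI0.
- move=> F mF tF F0.
  rewrite preimage_bigcup setI_bigcupr integral_bigcup//.
  + by rewrite eseries0.
  + apply/trivIsetP => i j _ _ ij; move/trivIsetP : tF => /(_ i j Logic.I Logic.I ij) tF.
    by rewrite setIACA -(preimage_setI f) tF preimage_set0 setI0.
  + by move=> k; exact: mpre.
  + rewrite -setI_bigcupr -preimage_bigcup; apply: ihS; exact: bigcupT_measurable.
Qed.

End IntegralDynkin.

Section Boxes.
Context {R : realType}.
Notation mR := (measurableTypeR R).

Lemma measurable_coord_x :
  measurable_fun [set: (mR * mR * mR)%type] (fun z => z.1.1 : mR).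
Proof. exact: (measurableT_comp measurable_fst measurable_fst). Qed.

Lemma measurable_coord_y :
  measurable_fun [set: (mR * mR * mR)%type] (fun z => z.1.2 : mR).
Proof. exact: (measurableT_comp measurable_snd measurable_fst). Qed.

Lemma measurable_coord_t :
  measurable_fun [set: (mR * mR * mR)%type] (fun z => z.2 : mR).
Proof. exact: measurable_snd. Qed.

Definition obox3 (l u : spacetime R) : set (spacetime R) :=
  `]l.1.1, u.1.1[%classic `*` `]l.1.2, u.1.2[%classic `*` `]l.2, u.2[%classic.

Definition cbox3 (l u : spacetime R) : set (spacetime R) :=
  `[l.1.1, u.1.1]%classic `*` `[l.1.2, u.1.2]%classic `*` `[l.2, u.2]%classic.

Lemma measurable_obox3 l u :
  measurable (obox3 l u : set (mR * mR * mR)%type).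
Proof. by apply: measurableX; [apply: measurableX|]; exact: measurable_itv. Qed.

Lemma obox3_sub_cbox3 l u : obox3 l u `<=` cbox3 l u.
Proof.
move=> z [[/=]]; rewrite !in_itv/= => /andP[h1 k1] /andP[h2 k2] /andP[h3 k3].
by split; [split|]; rewrite /= in_itv/= !ltW.
Qed.

Let Gray := @measurable_realfun.RGenOInfty.G R.

Let Gray_gen : @measurable _ mR = <<s Gray >>.
Proof. exact: measurable_realfun.RGenOInfty.measurableE. Qed.

Let Gray_I : setI_closed Gray.
Proof.
move=> _ _ [x ->] [y ->]; exists (Num.max x y).
apply/seteqP; split => z /=; rewrite !in_itv/= !andbT gt_max.
  by move=> [-> ->].
by move/andP.
Qed.

Let rayI (l u x : R) : `]l, u[%classic `&` `]x, +oo[%classic = `]Num.max l x, u[%classic.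
Proof.
apply/seteqP; split => z /=; rewrite !in_itv/= andbT gt_max.
  by move=> [/andP[-> ->] ->].
by move=> /andP[/andP[-> ->] ->].
Qed.

(** The half-lines ]x, +oo[ generate the Borel sets and meet an open box in an
    open box with the same upper corner, so that arbitrary Borel conditions can
    be put on x, y and t in turn; the Borel rectangles obtained generate the
    product sigma-algebra. *)
Lemma integral_boxes (h : spacetime R -> \bar R) (l u : spacetime R) :
  (@leb3 R).-integrable (obox3 l u) h ->
  (forall l' u', cbox3 l' u' `<=` cbox3 l u ->
    (\int[@leb3 R]_(z in obox3 l' u') h z = 0)%E) ->
  forall A : set (mR * mR * mR)%type, measurable A -> A `<=` obox3 l u ->
    (\int[@leb3 R]_(z in A) h z = 0)%E.
Proof.
move=> ih h0 A mA Alu.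
pose le3 (l' : spacetime R) := [/\ l.1.1 <= l'.1.1, l.1.2 <= l'.1.2 & l.2 <= l'.2].
pose X := (fun z : mR * mR * mR => z.1.1) : _ -> mR.
pose Y := (fun z : mR * mR * mR => z.1.2) : _ -> mR.
pose Z := (fun z : mR * mR * mR => z.2) : _ -> mR.
have mX : measurable_fun setT X by exact: measurable_coord_x.
have mY : measurable_fun setT Y by exact: measurable_coord_y.
have mZ : measurable_fun setT Z by exact: measurable_coord_t.
have mpre (f : mR * mR * mR -> mR) B : measurable_fun setT f -> measurable B ->
    measurable (f @^-1` B).
  by move=> mf mB; rewrite -[X in measurable X]setTI; exact: mf.
have leS l' : le3 l' -> obox3 l' u `<=` obox3 l u.
  move=> [h1 h2 h3] [[x y] t] [[]] /=; rewrite !in_itv/=.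
  move=> /andP[p1 q1] /andP[p2 q2] /andP[p3 q3].
  by split; [split|] => /=; rewrite in_itv/= ?q1 ?q2 ?q3 andbT;
    apply: le_lt_trans; eassumption.
have ihS (S : set (mR * mR * mR)%type) : measurable S -> S `<=` obox3 l u ->
    (@leb3 R).-integrable S h.
  by move=> mS Su; exact: (integrableS (measurable_obox3 l u) mS Su ih).
have ll : le3 l by [].
have st0 l' : le3 l' -> (\int[@leb3 R]_(z in obox3 l' u) h z = 0)%E.
  move=> [h1 h2 h3]; apply: h0 => -[[x y] t] [[]] /=; rewrite !in_itv/=.
  move=> /andP[p1 q1] /andP[p2 q2] /andP[p3 q3].
  by split; [split|] => /=; rewrite in_itv/= ?q1 ?q2 ?q3 andbT;
    apply: le_trans; eassumption.
have st1 A1 l' : measurable A1 -> le3 l' ->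
    (\int[@leb3 R]_(z in obox3 l' u `&` X @^-1` A1) h z = 0)%E.
  move=> mA1 ll'; apply: (integral_dynkin Gray_gen Gray_I mX) => //.
  - exact: measurable_obox3.
  - by apply: ihS; [exact: measurable_obox3|exact: leS].
  - exact: st0.
  - move=> _ [x ->].
    rewrite (_ : _ `&` _ = obox3 ((Num.max l'.1.1 x, l'.1.2), l'.2) u).
      by apply: st0; case: ll' => h1 h2 h3; split=> //=; rewrite le_max h1.
    rewrite /obox3/= -rayI; apply/seteqP.
    by split => -[[z1 z2] z3] /=; rewrite /X/=; tauto.
have st2 A1 A2 l' : measurable A1 -> measurable A2 -> le3 l' ->
    (\int[@leb3 R]_(z in (obox3 l' u `&` X @^-1` A1) `&` Y @^-1` A2) h z = 0)%E.
  move=> mA1 mA2 ll'.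
  have mS : measurable (obox3 l' u `&` X @^-1` A1 : set (mR * mR * mR)%type).
    by apply: measurableI; [exact: measurable_obox3|exact: mpre].
  apply: (integral_dynkin Gray_gen Gray_I mY) => //.
  - by apply: ihS => // z [+ _]; exact: leS.
  - exact: st1.
  - move=> _ [x ->].
    rewrite (_ : _ `&` Y @^-1` _ =
      obox3 ((l'.1.1, Num.max l'.1.2 x), l'.2) u `&` X @^-1` A1).
      by apply: st1 => //; case: ll' => h1 h2 h3; split=> //=; rewrite le_max h2.
    rewrite /obox3/= -rayI; apply/seteqP.
    by split => -[[z1 z2] z3] /=; rewrite /X/Y/=; tauto.
have st3 A1 A2 A3 : measurable A1 -> measurable A2 -> measurable A3 ->
    (\int[@leb3 R]_(z in (obox3 l u `&` X @^-1` A1 `&` Y @^-1` A2) `&` Z @^-1` A3) h z = 0)%E.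
  move=> mA1 mA2 mA3.
  have mS : measurable (obox3 l u `&` X @^-1` A1 `&` Y @^-1` A2 : set (mR * mR * mR)%type).
    apply: measurableI; last exact: mpre.
    by apply: measurableI; [exact: measurable_obox3|exact: mpre].
  apply: (integral_dynkin Gray_gen Gray_I mZ) => //.
  - by apply: ihS => // z [[]].
  - exact: st2.
  - move=> _ [x ->].
    rewrite (_ : _ `&` Z @^-1` _ =
      obox3 ((l.1.1, l.1.2), Num.max l.2 x) u `&` X @^-1` A1 `&` Y @^-1` A2).
      by apply: st2 => //; case: ll => h1 h2 h3; split=> //=; rewrite le_max h3.
    rewrite /obox3/= -rayI; apply/seteqP.
    by split => -[[z1 z2] z3] /=; rewrite /X/Y/Z/=; tauto.
(* The product is nested, so that its sigma-algebra is reached in two steps: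
   first a Borel set of the plane in place of A1 x A2, then one of space-time. *)
have st4 A12 A3 : measurable A12 -> measurable A3 ->
    (\int[@leb3 R]_(z in (obox3 l u `&` Z @^-1` A3) `&` fst @^-1` A12) h z = 0)%E.
  move=> mA12 mA3.
  apply: (integral_dynkin (measurable_prod_measurableType mR mR)) => //.
  - move=> _ _ [X1 mX1 [X2 mX2 <-]] [Y1 mY1 [Y2 mY2 <-]].
    exists (X1 `&` Y1); first exact: measurableI.
    by exists (X2 `&` Y2); [exact: measurableI|rewrite setXI].
  - by apply: measurableI; [exact: measurable_obox3|exact: mpre].
  - by apply: ihS => [|z []//]; apply: measurableI; [exact: measurable_obox3|exact: mpre].
  - by have := st3 setT setT A3 measurableT measurableT mA3; rewrite !preimage_setT !setIT.
  - move=> _ [X1 mX1 [X2 mX2 <-]].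
    rewrite (_ : _ `&` fst @^-1` _ =
      obox3 l u `&` X @^-1` X1 `&` Y @^-1` X2 `&` Z @^-1` A3).
      exact: st3.
    by apply/seteqP; split => -[[z1 z2] z3] /=; rewrite /X/Y/Z/=; tauto.
have := @integral_dynkin _ _ _ _ _ (@leb3 R) id _ (obox3 l u) h
  (measurable_prod_measurableType (mR * mR)%type mR) => /(_ _ _ _ _ _ _ A mA).
rewrite /= setIidr//; apply.
- move=> _ _ [X1 mX1 [X2 mX2 <-]] [Y1 mY1 [Y2 mY2 <-]].
  exists (X1 `&` Y1); first exact: measurableI.
  by exists (X2 `&` Y2); [exact: measurableI|rewrite setXI].
- exact: measurable_id.
- exact: measurable_obox3.
- exact: ih.
- exact: st0.
- move=> _ [X1 mX1 [X2 mX2 <-]].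
  rewrite (_ : _ `&` (X1 `*` X2) = obox3 l u `&` Z @^-1` X2 `&` fst @^-1` X1).
    exact: st4.
  by apply/seteqP; split => -[[z1 z2] z3] /=; rewrite /X/Y/Z/=; tauto.
Qed.

End Boxes.

Lemma negligible_bigcup_countType (d : measure_display) (T : measurableType d)
    (R : realType) (mu : {measure set T -> \bar R}) (U : countType)
    (F : U -> set T) :
  (forall q, mu.-negligible (F q)) -> mu.-negligible (\bigcup_q F q).
Proof.
move=> FN.
pose G n := if unpickle n is Some q then F q else set0.
apply: (@negligibleS _ _ _ _ (\bigcup_n G n)).
  by move=> z [q _ Fz]; exists (pickle q); rewrite // /G pickleK.
apply: negligible_bigcup => n; rewrite /G.
by case: unpickle => // ; exact: negligible_set0.
Qed.

(** * The fundamental lemma of the calculus of variations *)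

Section OpenSets.
Context {R : realType}.
Notation mR := (measurableTypeR R).

Let rat_between (x e : R) : 0 < e ->
  exists p q : rat, [/\ x - e < ratr p, ratr p < x, x < ratr q & ratr q < x + e].
Proof.
move=> e0.
have /rat_in_itvoo[p] : x - e < x by rewrite gtrBl.
have /rat_in_itvoo[q] : x < x + e by rewrite ltrDl.
by rewrite !in_itv/= => /andP[? ?] /andP[? ?]; exists p, q.
Qed.

Definition ratbox (q : (rat * rat * rat) * (rat * rat * rat)) :
    spacetime R * spacetime R :=
  (((ratr q.1.1.1, ratr q.1.1.2), ratr q.1.2),
   ((ratr q.2.1.1, ratr q.2.1.2), ratr q.2.2)).

(** Open sets are countable unions of rational boxes whose closures they
    contain; this gives their measurability and reduces almost-everywhere
    statements to boxes. *)
Lemma open_ratbox (K : set (spacetime R)) z : open K -> K z ->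
  exists q, cbox3 (ratbox q).1 (ratbox q).2 `<=` K /\
            obox3 (ratbox q).1 (ratbox q).2 z.
Proof.
move=> oK Kz.
have : nbhs z K by exact: open_nbhs_nbhs.
rewrite -nbhs_ballE => -[e /= e0 zeK].
have [p1 [q1 [a1 b1 c1 d1]]] := rat_between z.1.1 e0.
have [p2 [q2 [a2 b2 c2 d2]]] := rat_between z.1.2 e0.
have [p3 [q3 [a3 b3 c3 d3]]] := rat_between z.2 e0.
exists (((p1, p2), p3), ((q1, q2), q3)); split; last first.
  by split; [split|] => /=; rewrite in_itv/=; apply/andP.
move=> y [[/=]]; rewrite !in_itv/= => /andP[h1 k1] /andP[h2 k2] /andP[h3 k3].
by apply: zeK; split; [split|]; rewrite /ball/= ltr_norml; apply/andP; split; lra.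
Qed.

Lemma open_measurable3 (K : set (spacetime R)) : open K ->
  measurable (K : set (mR * mR * mR)%type).
Proof.
move=> oK.
have -> : K = \bigcup_q (if `[< cbox3 (ratbox q).1 (ratbox q).2 `<=` K >]
    then obox3 (ratbox q).1 (ratbox q).2 else set0).
  apply/seteqP; split => z.
    move=> /(open_ratbox oK)[q [qK zq]]; exists q => //.
    by case: asboolP.
  by move=> [q _]; case: asboolP => // qK /obox3_sub_cbox3 /qK.
apply: countable_bigcupT_measurable => // q.
by case: asboolP => _; [exact: measurable_obox3|exact: measurable0].
Qed.

Lemma openX (U V : topologicalType) (A : set U) (B : set V) :
  open A -> open B -> open (A `*` B).
Proof.
rewrite !openE => oA oB [x y] [/= Ax By].
by exists (A, B); [split; [exact: oA|exact: oB]|].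
Qed.

(** The plane is handled as a section of space-time. *)
Lemma open_measurable2 (P : set (plane R)) : open P ->
  measurable (P : set (mR * mR)%type).
Proof.
move=> oP.
have /(measurable_ysection (0 : mR)) := open_measurable3 (openX oP openT).
congr (measurable _); apply/seteqP; split => x; rewrite /ysection/= inE.
  by case.
by move=> Px; split.
Qed.

Lemma negligible_ratbox (K : set (spacetime R)) (N : set (mR * mR * mR)%type) :
  open K ->
  (forall l u, cbox3 l u `<=` K ->
    (@leb3 R).-negligible (obox3 l u `&` N)) ->
  (@leb3 R).-negligible (K `&` N).
Proof.
move=> oK NK.
pose F q : set (mR * mR * mR)%type :=
  if `[< cbox3 (ratbox q).1 (ratbox q).2 `<=` K >]
  then obox3 (ratbox q).1 (ratbox q).2 `&` N else set0.
have FN q : (@leb3 R).-negligible (F q).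
  by rewrite /F; case: asboolP => [|_]; [exact: NK|exact: negligible_set0].
apply: negligibleS (negligible_bigcup_countType FN).
move=> z [/(open_ratbox oK)[q [qK zq]] Nz]; exists q => //.
by rewrite /F; case: asboolP.
Qed.

End OpenSets.

Section FundamentalLemma.
Context {R : realType}.
Notation mR := (measurableTypeR R).

Lemma measurable_tensor3 (a b c : R -> R) : continuous a -> continuous b ->
  continuous c -> measurable_fun [set: (mR * mR * mR)%type] (tensor3 a b c).
Proof.
move=> ca cb cc.
have mX := @measurable_coord_x R; have mY := @measurable_coord_y R.
have mT := @measurable_coord_t R.
apply: measurable_funM; last first.
  exact: (measurableT_comp (continuous_measurable_fun cc) mT).
apply: measurable_funM.
  exact: (measurableT_comp (continuous_measurable_fun ca) mX).
exact: (measurableT_comp (continuous_measurable_fun cb) mY).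
Qed.

Lemma bump_bounded l u (a : R -> R) : bump l u a -> exists M, forall x, `|a x| <= M.
Proof.
move=> ba; have ca := bump_continuous ba.
have /compact_bounded[M [_ hM]] : compact (a @` `[l, u]%classic).
  by apply: continuous_compact; [exact: continuous_subspaceT|exact: segment_compact].
exists (`|M| + 1) => x.
have [xlu|xlu] := boolP (l <= x <= u).
  apply: hM; last by exists x => //=; rewrite in_itv.
  by rewrite (le_lt_trans (ler_norm M))// ltrDl.
case: ba => _ ->; first by rewrite normr0 addr_ge0.
by move: xlu; rewrite negb_and -!ltNge.
Qed.

Lemma tensor3_bounded (l u : spacetime R) (a b c : R -> R) :
  bump l.1.1 u.1.1 a -> bump l.1.2 u.1.2 b -> bump l.2 u.2 c ->
  exists M, forall z, `|tensor3 a b c z| <= M.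
Proof.
move=> /bump_bounded[A hA] /bump_bounded[B hB] /bump_bounded[C hC].
exists (A * B * C) => z; rewrite /tensor3 !normrM.
by apply: ler_pM => //; apply: ler_pM.
Qed.

Lemma bounded_on (T : Type) (D : set T) (f : T -> R) M :
  (forall x, `|f x| <= M) -> [bounded f x | x in D].
Proof.
move=> hM; exists M; split; first exact: num_real.
by move=> N MN x _; exact: le_trans (hM x) (ltW MN).
Qed.

(** Products of cutoffs converge boundedly to the indicator of the box. *)
Lemma integral_box_tensor (K : set (spacetime R)) (h : spacetime R -> R) l u :
  open K -> (@leb3 R).-integrable K (EFin \o h) -> cbox3 l u `<=` K ->
  (forall a b c, bump l.1.1 u.1.1 a -> bump l.1.2 u.1.2 b -> bump l.2 u.2 c ->
    (\int[@leb3 R]_(z in K) (h z * tensor3 a b c z)%:E = 0)%E) ->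
  (\int[@leb3 R]_(z in obox3 l u) (h z)%:E = 0)%E.
Proof.
move=> oK ih luK h0.
have mK := open_measurable3 oK.
have oluK : obox3 l u `<=` K := subset_trans (@obox3_sub_cbox3 R l u) luK.
pose T n := tensor3 (cutoff l.1.1 u.1.1 n) (cutoff l.1.2 u.1.2 n) (cutoff l.2 u.2 n).
have T0 n : (\int[@leb3 R]_(z in K) (h z * T n z)%:E = 0)%E.
  by apply: h0; exact: bump_cutoff.
have T01 n z : 0 <= T n z <= 1.
  have /andP[p1 q1] := cutoff01 l.1.1 u.1.1 n z.1.1.
  have /andP[p2 q2] := cutoff01 l.1.2 u.1.2 n z.1.2.
  have /andP[p3 q3] := cutoff01 l.2 u.2 n z.2.
  by rewrite /T /tensor3 !mulr_ge0//= mulr_ile1 ?mulr_ge0// mulr_ile1.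
have [mh _] := integrableP _ _ _ ih; move/measurable_EFinP in mh.
have mT n : measurable_fun [set: (mR * mR * mR)%type] (T n).
  by apply: measurable_tensor3; apply: bump_continuous; exact: bump_cutoff.
have mhT n : measurable_fun K (fun z => (h z * T n z)%:E).
  apply/measurable_EFinP; apply: measurable_funM => //.
  exact: measurable_funS (mT n).
have cT z : h z * T n z @[n --> \oo] --> (h z * \1_(obox3 l u) z : R).
  apply: cvgM; first exact: cvg_cst.
  have -> : \1_(obox3 l u) z = \1_(`]l.1.1, u.1.1[%classic) z.1.1 *
      \1_(`]l.1.2, u.1.2[%classic) z.1.2 * \1_(`]l.2, u.2[%classic) z.2 :> R.
    by rewrite /obox3 !indicE !in_setX -!natrM !mulnb.
  by apply: cvgM; [apply: cvgM|]; exact: cvg_cutoff.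
have mh1 : measurable_fun K (fun z => (h z * \1_(obox3 l u) z)%:E).
  apply/measurable_EFinP; apply: measurable_funM => //.
  exact: measurable_indic (measurable_obox3 _ _).
have [] := @dominated_convergence _ _ R (@leb3 R) K mK
  (fun n z => (h z * T n z)%:E) (fun z => (h z * \1_(obox3 l u) z)%:E)
  (fun z => `|(h z)%:E|%E) mhT mh1.
- by apply: aeW => z Kz; apply: cvg_EFin; [near=> n|exact: cT].
- exact: integrable_abse.
- apply: aeW => z n Kz /=; rewrite lee_fin normrM ler_piMr//.
  by have /andP[? ?] := T01 n z; rewrite ger0_norm.
move=> _ _; under eq_fun do rewrite T0.
move=> c0; rewrite -(setIidr oluK) integral_mkcondr.
rewrite -[RHS](cvg_unique (@ereal_hausdorff R) c0 (cvg_cst 0%E)).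
apply: eq_integral => z _; rewrite /patch indicE.
by case: ifP => _; rewrite ?mulr1 ?mulr0.
Unshelve. all: by end_near. Qed.

(** Testing with products supported in boxes suffices.  Boxes are required to be
    nonempty because the inclusion of an empty box in a cylinder says nothing
    about its factors. *)
Lemma fundamental_lemma (K : set (spacetime R)) (h : spacetime R -> R) :
  open K -> (@leb3 R).-integrable K (EFin \o h) ->
  (forall l u a b c, cbox3 l u !=set0 -> cbox3 l u `<=` K ->
    bump l.1.1 u.1.1 a -> bump l.1.2 u.1.2 b -> bump l.2 u.2 c ->
    \int[@leb3 R]_(z in K) (h z * tensor3 a b c z) = 0) ->
  {ae @leb3 R, forall z, K z -> h z = 0}.
Proof.
move=> oK ih h0.
have mK := open_measurable3 oK.
suff : (@leb3 R).-negligible (K `&` [set z | h z != 0]).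
  by apply: negligibleS => z /= /not_implyP[Kz /eqP hz].
apply: negligible_ratbox => // l u luK.
have oluK : obox3 l u `<=` K := subset_trans (@obox3_sub_cbox3 R l u) luK.
have ih' : (@leb3 R).-integrable (obox3 l u) (EFin \o h).
  by apply: (integrableS mK) => //; exact: measurable_obox3.
have : ae_eq (@leb3 R) (obox3 l u) (EFin \o h) (cst 0%E).
  apply: integral_ae_eq => //; first exact: measurable_obox3.
  move=> E Elu mE; rewrite integral0.
  apply: (integral_boxes ih') => // l' u' lu.
  have [c0|/set0P ne] := eqVneq (cbox3 l' u') set0.
    have -> : obox3 l' u' = set0 by rewrite -subset0 -c0; exact: obox3_sub_cbox3.
    exact: integral_set0.
  apply: (integral_box_tensor oK ih); first exact: subset_trans lu luK.
  move=> a b c ba bb bc.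
  have := h0 l' u' a b c ne (subset_trans lu luK) ba bb bc.
  rewrite /Rintegral => /eqP; rewrite fine_eq0; first by move=> /eqP.
  apply: integrable_fin_num => //.
  apply: (@integrableMl _ _ _ (@leb3 R) K mK (EFin \o h) (tensor3 a b c) ih).
    apply: measurable_funTS.
    exact: measurable_tensor3 (bump_continuous ba) (bump_continuous bb)
      (bump_continuous bc).
  have [M hM] := tensor3_bounded ba bb bc.
  exact: bounded_on hM.
by apply: negligibleS => z /= [zlu hz]; apply/not_implyP; split => //=; case; exact/eqP.
Qed.

End FundamentalLemma.

(** * Integrals of complex functions and Fubini's theorem *)

Section ComplexParts.
Context {R : realType}.
Implicit Types x y : R[i].

Lemma complex_ReD x y : complex.Re (x + y) = complex.Re x + complex.Re y.
Proof. by case: x y => [? ?] [? ?]. Qed.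
Lemma complex_ImD x y : complex.Im (x + y) = complex.Im x + complex.Im y.
Proof. by case: x y => [? ?] [? ?]. Qed.
Lemma complex_ReM x y : complex.Re (x * y) =
  complex.Re x * complex.Re y - complex.Im x * complex.Im y.
Proof. by case: x y => [? ?] [? ?]. Qed.
Lemma complex_ImM x y : complex.Im (x * y) =
  complex.Re x * complex.Im y + complex.Im x * complex.Re y.
Proof. by case: x y => [? ?] [? ?]. Qed.

Lemma normcE x : normc x = Num.sqrt (complex.Re x ^+ 2 + complex.Im x ^+ 2).
Proof. by case: x. Qed.

Lemma sqr_normc x : normc x ^+ 2 = complex.Re x ^+ 2 + complex.Im x ^+ 2.
Proof. by rewrite normcE sqr_sqrtr// addr_ge0 ?sqr_ge0. Qed.

Lemma Re_le_normc x : `|complex.Re x| <= normc x.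
Proof. by rewrite normcE -sqrtr_sqr ler_sqrt ?lerDl ?addr_ge0 ?sqr_ge0. Qed.

Lemma Im_le_normc x : `|complex.Im x| <= normc x.
Proof. by rewrite normcE -sqrtr_sqr ler_sqrt ?lerDr ?addr_ge0 ?sqr_ge0. Qed.

Lemma normc_le1D x : normc x <= 1 + normc x ^+ 2.
Proof. by have := sqr_ge0 (normc x - 1); rewrite sqrrB; nra. Qed.

End ComplexParts.

Section ComplexIntegral.
Context (R : realType) (d : measure_display) (T : measurableType d).
Variable mu : {measure set T -> \bar R}.
Implicit Types (D : set T) (f g : T -> R[i]).

Lemma in_L1D D f g : measurable D -> in_L1 mu D f -> in_L1 mu D g ->
  in_L1 mu D (fun x => f x + g x).
Proof.
move=> mD [f1 f2] [g1 g2]; split.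
  under eq_fun do rewrite complex_ReD EFinD.
  exact: integrableD.
under eq_fun do rewrite complex_ImD EFinD.
exact: integrableD.
Qed.

Lemma in_L1_mulr D f (h : T -> R) M : measurable D -> in_L1 mu D f ->
  measurable_fun D h -> (forall x, `|h x| <= M) ->
  in_L1 mu D (fun x => f x * (h x)%:C).
Proof.
move=> mD [f1 f2] mh hM.
have bh : [bounded h x | x in D] by exact: bounded_on hM.
split.
  under eq_fun do rewrite complex_ReM /= mulr0 subr0 EFinM.
  exact: integrableMl.
under eq_fun do rewrite complex_ImM /= mulr0 add0r EFinM.
exact: integrableMl.
Qed.

Lemma in_L1Z D f (c : R[i]) : measurable D -> in_L1 mu D f ->
  in_L1 mu D (fun x => c * f x).
Proof.
move=> mD [f1 f2]; split.
  under eq_fun do rewrite complex_ReM EFinB !EFinM.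
  by apply: integrableB => //; exact: integrableZl.
under eq_fun do rewrite complex_ImM EFinD !EFinM.
by apply: integrableD => //; exact: integrableZl.
Qed.

Lemma in_L1S D E f : measurable D -> measurable E -> E `<=` D ->
  in_L1 mu D f -> in_L1 mu E f.
Proof. by move=> mD mE ED [f1 f2]; split; exact: integrableS mD mE ED _. Qed.

Lemma CintegralD D f g : measurable D -> in_L1 mu D f -> in_L1 mu D g ->
  Cintegral mu D (fun x => f x + g x) = Cintegral mu D f + Cintegral mu D g.
Proof.
move=> mD [f1 f2] [g1 g2]; rewrite /Cintegral.
under eq_Rintegral do rewrite complex_ReD.
rewrite RintegralD//.
under [X in _ +i* X = _]eq_Rintegral do rewrite complex_ImD.
by rewrite RintegralD.
Qed.

Lemma CintegralZ D f (c : R[i]) : measurable D -> in_L1 mu D f ->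
  Cintegral mu D (fun x => c * f x) = c * Cintegral mu D f.
Proof.
move=> mD [f1 f2]; rewrite /Cintegral.
under eq_Rintegral do rewrite complex_ReM.
rewrite RintegralB//; [|exact: (@integrableZl _ _ _ mu D mD _ _ f1)
                       |exact: (@integrableZl _ _ _ mu D mD _ _ f2)].
rewrite !RintegralZl//.
under [X in _ +i* X = _]eq_Rintegral do rewrite complex_ImM.
rewrite RintegralD//; [|exact: (@integrableZl _ _ _ mu D mD _ _ f2)
                       |exact: (@integrableZl _ _ _ mu D mD _ _ f1)].
by rewrite !RintegralZl//; case: c.
Qed.

Lemma eq_Cintegral D f g : (forall x, D x -> f x = g x) ->
  Cintegral mu D f = Cintegral mu D g.
Proof.
by move=> fg; rewrite /Cintegral; congr (_ +i* _); apply: eq_Rintegral => x /set_mem /fg ->.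
Qed.

Lemma ae_eq_Cintegral D f g : measurable D -> in_L1 mu D f -> in_L1 mu D g ->
  {ae mu, forall x, D x -> f x = g x} -> Cintegral mu D f = Cintegral mu D g.
Proof.
move=> mD [/integrableP[f1 _] /integrableP[f2 _]] [/integrableP[g1 _] /integrableP[g2 _]] fg.
rewrite /Cintegral /Rintegral; congr (fine _ +i* fine _); apply: ae_eq_integral => //.
  by apply: filterS fg => x /[apply] ->.
by apply: filterS fg => x /[apply] ->.
Qed.

Lemma measurable_normc D f : measurable_fun D (fun x => complex.Re (f x)) ->
  measurable_fun D (fun x => complex.Im (f x)) ->
  measurable_fun D (fun x => normc (f x)).
Proof.
move=> mr mi; under eq_fun do rewrite normcE.
apply: (measurableT_comp (continuous_measurable_fun (@sqrt_continuous R))).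
by apply: measurable_funD; exact: measurable_funX.
Qed.

Lemma in_L2_sqr_integrable D f : in_L2 mu D f ->
  mu.-integrable D (fun x => (normc (f x) ^+ 2)%:E).
Proof.
move=> [mr mi f2]; apply/integrableP; split.
  by apply/measurable_EFinP; apply: measurable_funX; exact: measurable_normc.
under eq_integral do rewrite gee0_abs ?lee_fin ?sqr_ge0//.
exact: f2.
Qed.

Lemma in_L2_L1 D f : measurable D -> (mu D < +oo)%E -> in_L2 mu D f ->
  in_L1 mu D f.
Proof.
move=> mD Doo fL2; have i2 := in_L2_sqr_integrable fL2; have [mr mi _] := fL2.
have i1 : mu.-integrable D (EFin \o cst (1:R)).
  apply: measurable_bounded_integrable => //.
  exists 1; split; first exact: num_real.
  by move=> N N1 x _; rewrite /= normr1 ltW.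
have i12 : mu.-integrable D (fun x => (1 + normc (f x) ^+ 2)%:E).
  under eq_fun do rewrite EFinD.
  exact: integrableD.
split.
  apply: le_integrable i12 => //; first exact/measurable_EFinP.
  move=> x _ /=; rewrite lee_fin (le_trans (Re_le_normc _))//.
  by rewrite (le_trans (normc_le1D _)) ?ler_norm.
apply: le_integrable i12 => //; first exact/measurable_EFinP.
move=> x _ /=; rewrite lee_fin (le_trans (Im_le_normc _))//.
by rewrite (le_trans (normc_le1D _)) ?ler_norm.
Qed.

End ComplexIntegral.

Section FubiniAe.
Context d1 d2 (T1 : measurableType d1) (T2 : measurableType d2) (R : realType).
Variable m1 : {sigma_finite_measure set T1 -> \bar R}.
Variable m2 : {sigma_finite_measure set T2 -> \bar R}.
Variables (A : set T1) (B : set T2).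
Hypotheses (mA : measurable A) (mB : measurable B).

Let mAB : measurable (A `*` B). Proof. exact: measurableX. Qed.

Let patchX (f : T1 * T2 -> R) x y :
  ((EFin \o f) \_ (A `*` B)) (x, y) =
  if x \in A then ((EFin \o (fun y => f (x, y))) \_ B) y else 0%E.
Proof. by rewrite /patch in_setX/=; case: (x \in A). Qed.

Let patchX' (f : T1 * T2 -> R) x y :
  ((EFin \o f) \_ (A `*` B)) (x, y) =
  if y \in B then ((EFin \o (fun x => f (x, y))) \_ A) x else 0%E.
Proof. by rewrite /patch in_setX/= andbC; case: (y \in B). Qed.

Lemma ae_section_integrable1 (f : T1 * T2 -> R) :
  (m1 \x m2)%E.-integrable (A `*` B) (EFin \o f) ->
  {ae m1, forall x, A x -> m2.-integrable B (EFin \o (fun y => f (x, y)))}.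
Proof.
move=> /(integrable_mkcond _ mAB)/ae_integrable1; apply: filterS => x /= + Ax.
under eq_fun do rewrite patchX mem_set//.
by move=> h; apply/(integrable_mkcond _ mB).
Qed.

Lemma ae_section_integrable2 (f : T1 * T2 -> R) :
  (m1 \x m2)%E.-integrable (A `*` B) (EFin \o f) ->
  {ae m2, forall y, B y -> m1.-integrable A (EFin \o (fun x => f (x, y)))}.
Proof.
move=> /(integrable_mkcond _ mAB)/ae_integrable2; apply: filterS => y /= + By.
under eq_fun do rewrite patchX' mem_set//.
by move=> h; apply/(integrable_mkcond _ mA).
Qed.

(** Fubini's theorem in the form in which derivatives taken section by section
    are used: two functions whose sections have equal integrals almost
    everywhere have equal integrals. *)
Lemma ae_eq_Rintegral_section1 (f g : T1 * T2 -> R) :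
  (m1 \x m2)%E.-integrable (A `*` B) (EFin \o f) ->
  (m1 \x m2)%E.-integrable (A `*` B) (EFin \o g) ->
  {ae m1, forall x, A x ->
    \int[m2]_(y in B) f (x, y) = \int[m2]_(y in B) g (x, y)} ->
  \int[(m1 \x m2)%E]_(z in A `*` B) f z = \int[(m1 \x m2)%E]_(z in A `*` B) g z.
Proof.
move=> fi gi fg.
have fi' := (integrable_mkcond _ mAB).1 fi.
have gi' := (integrable_mkcond _ mAB).1 gi.
rewrite /Rintegral; congr fine.
rewrite integral_mkcond [RHS]integral_mkcond.
rewrite -(integral12_prod_meas1 fi') -(integral12_prod_meas1 gi').
apply: ae_eq_integral => //.
- exact: (measurable_fubini_F fi').
- exact: (measurable_fubini_F gi').
apply: filterS3 fg (ae_section_integrable1 fi) (ae_section_integrable1 gi).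
move=> x fg fx gx _; rewrite /fubini_F.
under eq_integral do rewrite patchX.
under [RHS]eq_integral do rewrite patchX.
have [xA|xA] := boolP (x \in A); last by [].
rewrite -!integral_mkcond.
have Ax := set_mem xA.
have ffin := integrable_fin_num mB (fx Ax).
have gfin := integrable_fin_num mB (gx Ax).
by rewrite -(fineK ffin) -(fineK gfin); congr EFin; exact: fg.
Qed.

Lemma ae_eq_Rintegral_section2 (f g : T1 * T2 -> R) :
  (m1 \x m2)%E.-integrable (A `*` B) (EFin \o f) ->
  (m1 \x m2)%E.-integrable (A `*` B) (EFin \o g) ->
  {ae m2, forall y, B y ->
    \int[m1]_(x in A) f (x, y) = \int[m1]_(x in A) g (x, y)} ->
  \int[(m1 \x m2)%E]_(z in A `*` B) f z = \int[(m1 \x m2)%E]_(z in A `*` B) g z.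
Proof.
move=> fi gi fg.
have fi' := (integrable_mkcond _ mAB).1 fi.
have gi' := (integrable_mkcond _ mAB).1 gi.
rewrite /Rintegral; congr fine.
rewrite integral_mkcond [RHS]integral_mkcond.
rewrite -(integral21_prod_meas1 fi') -(integral21_prod_meas1 gi').
apply: ae_eq_integral => //.
- exact: (measurable_fubini_G fi').
- exact: (measurable_fubini_G gi').
apply: filterS3 fg (ae_section_integrable2 fi) (ae_section_integrable2 gi).
move=> y fg fx gx _; rewrite /fubini_G.
under eq_integral do rewrite patchX'.
under [RHS]eq_integral do rewrite patchX'.
have [yB|yB] := boolP (y \in B); last by [].
rewrite -!integral_mkcond.
have By := set_mem yB.
have ffin := integrable_fin_num mA (fx By).
have gfin := integrable_fin_num mA (gx By).
by rewrite -(fineK ffin) -(fineK gfin); congr EFin; exact: fg.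
Qed.

Implicit Types F G : T1 * T2 -> R[i].

Lemma ae_section_L1_1 F : in_L1 (m1 \x m2)%E (A `*` B) F ->
  {ae m1, forall x, A x -> in_L1 m2 B (fun y => F (x, y))}.
Proof.
move=> [/ae_section_integrable1 h1 /ae_section_integrable1 h2].
by apply: filterS2 h1 h2 => x h1 h2 Ax; split; [exact: h1|exact: h2].
Qed.

Lemma ae_section_L1_2 F : in_L1 (m1 \x m2)%E (A `*` B) F ->
  {ae m2, forall y, B y -> in_L1 m1 A (fun x => F (x, y))}.
Proof.
move=> [/ae_section_integrable2 h1 /ae_section_integrable2 h2].
by apply: filterS2 h1 h2 => x h1 h2 Ax; split; [exact: h1|exact: h2].
Qed.

Lemma ae_eq_Cintegral_section1 F G :
  in_L1 (m1 \x m2)%E (A `*` B) F -> in_L1 (m1 \x m2)%E (A `*` B) G ->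
  {ae m1, forall x, A x ->
    Cintegral m2 B (fun y => F (x, y)) = Cintegral m2 B (fun y => G (x, y))} ->
  Cintegral (m1 \x m2)%E (A `*` B) F = Cintegral (m1 \x m2)%E (A `*` B) G.
Proof.
move=> [f1 f2] [g1 g2] FG; rewrite /Cintegral; congr (_ +i* _).
  apply: ae_eq_Rintegral_section1 => //.
  by apply: filterS FG => x /[apply] -[].
apply: ae_eq_Rintegral_section1 => //.
by apply: filterS FG => x /[apply] -[].
Qed.

Lemma ae_eq_Cintegral_section2 F G :
  in_L1 (m1 \x m2)%E (A `*` B) F -> in_L1 (m1 \x m2)%E (A `*` B) G ->
  {ae m2, forall y, B y ->
    Cintegral m1 A (fun x => F (x, y)) = Cintegral m1 A (fun x => G (x, y))} ->
  Cintegral (m1 \x m2)%E (A `*` B) F = Cintegral (m1 \x m2)%E (A `*` B) G.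
Proof.
move=> [f1 f2] [g1 g2] FG; rewrite /Cintegral; congr (_ +i* _).
  apply: ae_eq_Rintegral_section2 => //.
  by apply: filterS FG => x /[apply] -[].
apply: ae_eq_Rintegral_section2 => //.
by apply: filterS FG => x /[apply] -[].
Qed.

End FubiniAe.

(** * The Schroedinger equation for weak derivatives *)

(* Instance resolution does not unfold leb1, leb2 and leb3. *)
#[local] Instance ae_filter_leb1 (R : realType) :
  Filter (nbhs (almost_everywhere (@leb1 R))).
Proof. exact: (@ae_filter_ringOfSetsType _ _ _ (@leb1 R : {measure set _ -> \bar R})). Qed.

#[local] Instance ae_filter_leb2 (R : realType) :
  Filter (nbhs (almost_everywhere (@leb2 R))).
Proof. exact: (@ae_filter_ringOfSetsType _ _ _ (@leb2 R : {measure set _ -> \bar R})). Qed.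

#[local] Instance ae_filter_leb3 (R : realType) :
  Filter (nbhs (almost_everywhere (@leb3 R))).
Proof. exact: (@ae_filter_ringOfSetsType _ _ _ (@leb3 R : {measure set _ -> \bar R})). Qed.

Section FiniteMeasure.
Context {R : realType}.
Notation mR := (measurableTypeR R).

Lemma leb1_itv_lty (a b : R) : (@leb1 R `]a, b[%classic < +oo)%E.
Proof. by rewrite /leb1 lebesgue_measure_itv; case: ifP => _; rewrite ?ltry. Qed.

Lemma leb2_bounded_lty (P : set (plane R)) : open P -> bounded_set P ->
  (@leb2 R P < +oo)%E.
Proof.
move=> oP [M [_ hM]].
pose N := `|M| + 1.
have PN : P `<=` `]- N - 1, N + 1[%classic `*` `]- N - 1, N + 1[%classic.
  move=> z Pz.
  have : `|z| <= N by apply: hM => //; rewrite /N (le_lt_trans (ler_norm M))// ltrDl.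
  rewrite prod_normE/= ge_max !ler_norml => /andP[/andP[p1 q1] /andP[p2 q2]].
  by split; rewrite /= in_itv/=; apply/andP; split; lra.
have mI : measurable (`]- N - 1, N + 1[%classic : set mR) by exact: measurable_itv.
apply: (@le_lt_trans _ _ (@leb2 R (`]- N - 1, N + 1[%classic `*` `]- N - 1, N + 1[%classic))).
  apply: le_measure => //; rewrite inE.
    exact: open_measurable2.
  exact: measurableX.
rewrite /leb2 product_measure1E//; apply: lte_mul_pinfty => //.
  by rewrite ge0_fin_numE// leb1_itv_lty.
exact: leb1_itv_lty.
Qed.

Lemma leb3_cylinder_lty (P : set (plane R)) (ta tb : R) : open P -> bounded_set P ->
  (@leb3 R (P `*` `]ta, tb[%classic) < +oo)%E.
Proof.
move=> oP bP.
have mI : measurable (`]ta, tb[%classic : set mR) by exact: measurable_itv.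
have mP := open_measurable2 oP.
rewrite /leb3 product_measure1E//; apply: lte_mul_pinfty => //.
  by rewrite ge0_fin_numE// leb2_bounded_lty.
exact: leb1_itv_lty.
Qed.

End FiniteMeasure.

Section Pairing.
Context {R : realType}.
Notation mR := (measurableTypeR R).
Variables (P : set (plane R)) (ta tb : R).
Hypotheses (oP : open P) (bP : bounded_set P).
Let I : set R := `]ta, tb[%classic.
Let K : set (spacetime R) := P `*` I.
Implicit Types (f g : spacetime R -> R[i]) (l u : spacetime R) (a b c : R -> R).

Let mP : measurable (P : set (mR * mR)%type). Proof. exact: open_measurable2. Qed.
Let mI : measurable (I : set mR). Proof. exact: measurable_itv. Qed.
Let mK : measurable (K : set (mR * mR * mR)%type). Proof. exact: measurableX. Qed.
Let oK : open K. Proof. by apply: openX => //; exact: interval_open. Qed.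

Definition pairing f (T : spacetime R -> R) : R[i] :=
  Cintegral (@leb3 R) K (fun z => f z * (T z)%:C).

Definition bump3 l u a b c :=
  [/\ bump l.1.1 u.1.1 a, bump l.1.2 u.1.2 b & bump l.2 u.2 c].

Lemma in_L1_tensor3 l u a b c f : bump3 l u a b c -> in_L1 (@leb3 R) K f ->
  in_L1 (@leb3 R) K (fun z => f z * (tensor3 a b c z)%:C).
Proof.
move=> [ba bb bc] fi.
have [M hM] := tensor3_bounded ba bb bc.
apply: (@in_L1_mulr _ _ _ (@leb3 R) K f (tensor3 a b c) M) => //.
apply: measurable_funTS.
exact: measurable_tensor3 (bump_continuous ba) (bump_continuous bb)
  (bump_continuous bc).
Qed.

Lemma pairingD l u a b c f g : bump3 l u a b c ->
  in_L1 (@leb3 R) K f -> in_L1 (@leb3 R) K g ->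
  pairing (fun z => f z + g z) (tensor3 a b c) =
  pairing f (tensor3 a b c) + pairing g (tensor3 a b c).
Proof.
move=> b3 fi gi; rewrite /pairing -CintegralD//.
- by apply: eq_Cintegral => z _; rewrite mulrDl.
- exact: in_L1_tensor3 b3 fi.
- exact: in_L1_tensor3 b3 gi.
Qed.

Lemma pairingZ l u a b c f (k : R[i]) : bump3 l u a b c ->
  in_L1 (@leb3 R) K f ->
  pairing (fun z => k * f z) (tensor3 a b c) = k * pairing f (tensor3 a b c).
Proof.
move=> b3 fi; rewrite /pairing -CintegralZ//.
- by apply: eq_Cintegral => z _; rewrite mulrA.
- exact: in_L1_tensor3 b3 fi.
Qed.

Lemma pairing_ae0 l u a b c f : bump3 l u a b c -> in_L1 (@leb3 R) K f ->
  {ae @leb3 R, forall z, K z -> f z = 0} -> pairing f (tensor3 a b c) = 0.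
Proof.
move=> b3 fi f0.
have i0 : in_L1 (@leb3 R) K (fun=> 0) by split; exact: integrable0.
rewrite /pairing (@ae_eq_Cintegral _ _ _ (@leb3 R) K _ (fun=> 0)) //.
- by rewrite /Cintegral /= /Rintegral integral0.
- exact: in_L1_tensor3 b3 fi.
- by apply: filterS f0 => z /[apply] ->; rewrite mul0r.
Qed.

Lemma fundamental_lemma_complex f : in_L1 (@leb3 R) K f ->
  (forall l u a b c, cbox3 l u !=set0 -> cbox3 l u `<=` K ->
    bump3 l u a b c -> pairing f (tensor3 a b c) = 0) ->
  {ae @leb3 R, forall z, K z -> f z = 0}.
Proof.
move=> [f1 f2] f0.
have r0 : {ae @leb3 R, forall z, K z -> complex.Re (f z) = 0}.
  apply: fundamental_lemma => // l u a b c ne luK ba bb bc.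
  have [h _] := f0 l u a b c ne luK (And3 ba bb bc).
  by rewrite -[RHS]h; apply: eq_Rintegral => z _; rewrite complex_ReM /= mulr0 subr0.
have i0 : {ae @leb3 R, forall z, K z -> complex.Im (f z) = 0}.
  apply: fundamental_lemma => // l u a b c ne luK ba bb bc.
  have [_ h] := f0 l u a b c ne luK (And3 ba bb bc).
  by rewrite -[RHS]h; apply: eq_Rintegral => z _; rewrite complex_ImM /= mulr0 add0r.
apply: filterS2 r0 i0 => z + + Kz => /(_ Kz) + /(_ Kz).
by case: (f z) => x y /= -> ->.
Qed.

Lemma bump3_derive l u a b c (j : multi_index) : bump3 l u a b c ->
  bump3 l u (derive1n j.1.1 a) (derive1n j.1.2 b) (derive1n j.2 c).
Proof. by case=> ba bb bc; split; exact: bump_derive1n. Qed.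

Lemma pairing_weak_derivative l u a b c (j : multi_index) f g :
  cbox3 l u `<=` K -> bump3 l u a b c -> is_weak_derivative K j f g ->
  pairing f (tensor3 (derive1n j.1.1 a) (derive1n j.1.2 b) (derive1n j.2 c)) =
  (-1) ^+ mi_order j * pairing g (tensor3 a b c).
Proof.
move=> luK [ba bb bc] [_] /(_ (tensor3 a b c)).
rewrite Dmi_tensor3; [|by case: ba|by case: bb|by case: bc].
by apply; exact: test_function_tensor3 ba bb bc luK.
Qed.

(** The time derivative is known at almost every point of P only for a fixed test
    function of time.  For a product the factor a(x) b(y) is a constant on the
    sections, so that the exceptional set is the one of c. *)
Lemma pairing_bochner_dt l u a b c f g :
  cbox3 l u !=set0 -> cbox3 l u `<=` K -> bump3 l u a b c ->
  in_L1 (@leb3 R) K f -> in_L1 (@leb3 R) K g -> bochner_dt P I f g ->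
  pairing f (tensor3 a b (derive1 c)) = - pairing g (tensor3 a b c).
Proof.
move=> [z0 [z1 z2]] luK b3 fi gi [_ fg].
have b3' : bump3 l u a b (derive1 c) := bump3_derive ((0, 0), 1)%N b3.
have [ba bb bc] := b3.
have cI : `[l.2, u.2]%classic `<=` I.
  by move=> t lut; have [] := luK (z0.1, t) (conj z1 lut).
have {}fg := fg c (test_function_bump bc cI).
rewrite -mulN1r -(pairingZ _ b3 gi).
apply: (@ae_eq_Cintegral_section1 _ _ _ _ R (@leb2 R) (@leb1 R) P I mP mI).
- exact: in_L1_tensor3 b3' fi.
- by apply: in_L1_tensor3 b3 _; exact: in_L1Z.
apply: filterS3 fg (ae_section_L1_1 mP mI fi) (ae_section_L1_1 mP mI gi).
move=> x + + + Px => /(_ Px) fg /(_ Px) fx /(_ Px) gx.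
have L1 h h' : bump l.2 u.2 h -> in_L1 (@leb1 R) I (fun t => h' (x, t)) ->
    in_L1 (@leb1 R) I (fun t => h' (x, t) * (h t)%:C).
  move=> bh h'i; have [M hM] := bump_bounded bh.
  apply: (@in_L1_mulr _ _ _ (@leb1 R) I _ h M) => //.
  by apply: measurable_funTS; apply: continuous_measurable_fun; exact: bump_continuous bh.
transitivity ((a x.1 * b x.2)%:C *
    Cintegral (@leb1 R) I (fun t => f (x, t) * (derive1 c t)%:C)).
  rewrite -CintegralZ//; last by apply: L1 => //; exact: bump_derive1.
  by apply: eq_Cintegral => t _; rewrite /tensor3/= !rmorphM/=; ring.
rewrite fg -[- Cintegral _ _ _]mulN1r mulrA -CintegralZ//; last exact: L1.
by apply: eq_Cintegral => t _; rewrite /tensor3/= !rmorphM/=; ring.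
Qed.

Lemma pairing_bochner_dx l u a b c (al : nat * nat) f g :
  cbox3 l u !=set0 -> cbox3 l u `<=` K -> bump3 l u a b c ->
  in_L1 (@leb3 R) K f -> in_L1 (@leb3 R) K g -> bochner_dx P I al f g ->
  pairing f (tensor3 (derive1n al.1 a) (derive1n al.2 b) c) =
  (-1) ^+ (al.1 + al.2)%N * pairing g (tensor3 a b c).
Proof.
move=> [z0 [z1 z2]] luK b3 fi gi [_ fg].
have b3' : bump3 l u (derive1n al.1 a) (derive1n al.2 b) c := bump3_derive (al, 0)%N b3.
have [ba bb bc] := b3.
have abP : `[l.1.1, u.1.1]%classic `*` `[l.1.2, u.1.2]%classic `<=` P.
  by move=> x lux; have [] := luK (x, z0.2) (conj lux z2).
rewrite -(pairingZ _ b3 gi).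
apply: (@ae_eq_Cintegral_section2 _ _ _ _ R (@leb2 R) (@leb1 R) P I mP mI).
- exact: in_L1_tensor3 b3' fi.
- by apply: in_L1_tensor3 b3 _; exact: in_L1Z.
apply: filterS3 fg (ae_section_L1_2 mP mI fi) (ae_section_L1_2 mP mI gi).
move=> t + + + It => /(_ It) [_ fg] /(_ It) ft /(_ It) gt.
have {}fg := fg _ (test_function_tensor2 ba bb abP).
rewrite Dspace_tensor2 in fg; [|by case: ba|by case: bb].
have L1 h1 h2 h' : bump l.1.1 u.1.1 h1 -> bump l.1.2 u.1.2 h2 ->
    in_L1 (@leb2 R) P (fun x => h' (x, t)) ->
    in_L1 (@leb2 R) P (fun x => h' (x, t) * (tensor2 h1 h2 x)%:C).
  move=> bh1 bh2 h'i.
  have [M hM] := bump_bounded bh1; have [N hN] := bump_bounded bh2.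
  apply: (@in_L1_mulr _ _ _ (@leb2 R) P _ (tensor2 h1 h2) (M * N)) => //.
    apply: measurable_funTS; apply: measurable_funM.
      exact: (measurableT_comp
        (continuous_measurable_fun (bump_continuous bh1)) measurable_fst).
    exact: (measurableT_comp
        (continuous_measurable_fun (bump_continuous bh2)) measurable_snd).
  by move=> x; rewrite /tensor2 normrM ler_pM.
transitivity ((c t)%:C * Cintegral (@leb2 R) P (fun x =>
    f (x, t) * (tensor2 (derive1n al.1 a) (derive1n al.2 b) x)%:C)).
  rewrite -CintegralZ//; last by apply: L1 => //; exact: bump_derive1n.
  by apply: eq_Cintegral => x _; rewrite /tensor3/tensor2/= !rmorphM/=; ring.
rewrite fg mulrA -CintegralZ//; last exact: L1.
by apply: eq_Cintegral => x _; rewrite /tensor3/tensor2/= !rmorphM/=; ring.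
Qed.

Variables (V : spacetime R -> R) (v : R) (q : nat) (psi : spacetime R -> R[i]).
Hypotheses (Vv : forall z, K z -> V z = v).
Hypotheses (trefftz_psi : trefftz_space P I V psi) (sobolev_psi : in_sobolev q K psi).

Lemma weakDP (j : multi_index) : (mi_order j <= q)%N ->
  is_weak_derivative K j psi (weakD K j psi).
Proof.
case: sobolev_psi => _ /[apply] -[g wg].
exact: (@xgetPex _ (fun=> 0) [set g | is_weak_derivative K j psi g] (ex_intro _ g wg)).
Qed.

Let L1 f : in_L2 (@leb3 R) K f -> in_L1 (@leb3 R) K f.
Proof. by apply: in_L2_L1 => //; exact: leb3_cylinder_lty. Qed.

Lemma weakD_L1 (j : multi_index) : (mi_order j <= q)%N ->
  in_L1 (@leb3 R) K (weakD K j psi).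
Proof. by move=> /weakDP[/L1]. Qed.

(** Pairing with a product moves D^j onto the factors.  What remains is the
    pairing of psi with derivatives of the product of a^(jx), b^(jy) and c^(jt),
    which is again a product of smooth compactly supported functions, so that the
    equation itself can be applied. *)
Lemma weakD_schroedinger (jx jy jt : nat) : (jx + jy + jt + 2 <= q)%N ->
  {ae @leb3 R, forall z, K z ->
    'i%C * weakD K ((jx, jy), jt.+1) psi z +
    (weakD K ((jx.+2, jy), jt) psi z + weakD K ((jx, jy.+2), jt) psi z) +
    - v%:C * weakD K ((jx, jy), jt) psi z = 0}.
Proof.
move=> jq.
have [_ _ [ft [fxx [fyy [dt dxx dyy pde]]]]] := trefftz_psi.
pose wt := weakD K ((jx, jy), jt.+1) psi.
pose wxx := weakD K ((jx.+2, jy), jt) psi.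
pose wyy := weakD K ((jx, jy.+2), jt) psi.
pose w := weakD K ((jx, jy), jt) psi.
have Lpsi : in_L1 (@leb3 R) K psi by case: sobolev_psi => /L1.
have Lwt : in_L1 (@leb3 R) K wt by apply: weakD_L1; rewrite /mi_order/=; lia.
have Lwxx : in_L1 (@leb3 R) K wxx by apply: weakD_L1; rewrite /mi_order/=; lia.
have Lwyy : in_L1 (@leb3 R) K wyy by apply: weakD_L1; rewrite /mi_order/=; lia.
have Lw : in_L1 (@leb3 R) K w by apply: weakD_L1; rewrite /mi_order/=; lia.
have Lft : in_L1 (@leb3 R) K ft by case: dt => /L1.
have Lfxx : in_L1 (@leb3 R) K fxx by case: dxx => /L1.
have Lfyy : in_L1 (@leb3 R) K fyy by case: dyy => /L1.
have Lc (f1 f2 f3 f4 : spacetime R -> R[i]) : in_L1 (@leb3 R) K f1 -> in_L1 (@leb3 R) K f2 ->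
    in_L1 (@leb3 R) K f3 -> in_L1 (@leb3 R) K f4 ->
    in_L1 (@leb3 R) K (fun z => 'i%C * f1 z + (f2 z + f3 z) + - v%:C * f4 z).
  move=> h1 h2 h3 h4; apply: in_L1D => //; last exact: in_L1Z.
  by apply: in_L1D => //; [exact: in_L1Z|exact: in_L1D].
have lin l u a b c (f1 f2 f3 f4 : spacetime R -> R[i]) : bump3 l u a b c ->
    in_L1 (@leb3 R) K f1 -> in_L1 (@leb3 R) K f2 ->
    in_L1 (@leb3 R) K f3 -> in_L1 (@leb3 R) K f4 ->
    pairing (fun z => 'i%C * f1 z + (f2 z + f3 z) + - v%:C * f4 z) (tensor3 a b c) =
    'i%C * pairing f1 (tensor3 a b c) +
    (pairing f2 (tensor3 a b c) + pairing f3 (tensor3 a b c)) +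
    - v%:C * pairing f4 (tensor3 a b c).
  move=> b3 h1 h2 h3 h4.
  rewrite (pairingD b3); [| |exact: in_L1Z]; last first.
    by apply: in_L1D => //; [exact: in_L1Z|exact: in_L1D].
  rewrite (pairingD b3); [|exact: in_L1Z|exact: in_L1D].
  by rewrite !(pairingZ _ b3)// (pairingD b3).
apply: (@fundamental_lemma_complex (fun z => 'i%C * wt z + (wxx z + wyy z) + - v%:C * w z)).
  exact: Lc.
move=> l u a b c ne luK b3; rewrite (lin l u)//.
have wD j : (mi_order j <= q)%N -> pairing (weakD K j psi) (tensor3 a b c) =
    (-1) ^+ mi_order j * pairing psi
      (tensor3 (derive1n j.1.1 a) (derive1n j.1.2 b) (derive1n j.2 c)).
  move=> jq'; rewrite (pairing_weak_derivative luK b3 (weakDP jq')) mulrA.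
  by rewrite -exprD addnn -mul2n exprM sqrrN expr1n expr1n mul1r.
rewrite !wD /mi_order/=; try lia.
have b3j : bump3 l u _ _ _ := bump3_derive ((jx, jy), jt) b3.
rewrite (pairing_bochner_dt ne luK b3j Lpsi Lft dt).
have := pairing_bochner_dx ne luK b3j Lpsi Lfxx dxx => /= ->.
have := pairing_bochner_dx ne luK b3j Lpsi Lfyy dyy => /= ->.
have := pairing_ae0 b3j (Lc ft fxx fyy psi Lft Lfxx Lfyy Lpsi).
rewrite (lin _ _ _ _ _ _ _ _ _ b3j)//= => pde0.
transitivity ((-1) ^+ (jx + jy + jt) * ('i%C *
    pairing ft (tensor3 (derive1n jx a) (derive1n jy b) (derive1n jt c)) +
   (pairing fxx (tensor3 (derive1n jx a) (derive1n jy b) (derive1n jt c)) +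
    pairing fyy (tensor3 (derive1n jx a) (derive1n jy b) (derive1n jt c))) +
   - v%:C * pairing psi (tensor3 (derive1n jx a) (derive1n jy b) (derive1n jt c)))).
  rewrite !addSn !addnS !addSn !exprS; ring.
rewrite pde0 ?mulr0//.
by apply: filterS pde => z + Kz => /(_ Kz); rewrite Vv// mulNr.
Qed.

End Pairing.

(** * Unisolvence of plane-wave jets *)

Section Unisolvence.
Variables (F : fieldType) (p : nat).

Definition wave_index := {m : 'I_p.+1 & 'I_(2 * m).+1}.
Implicit Types (s t : wave_index).

Section Moments.
Variables (kappa : 'I_p.+1 -> F) (w : forall m : 'I_p.+1, 'I_(2 * m).+1 -> F).
Arguments w : clear implicits.
Hypothesis kappa0 : forall m, kappa m != 0.
Hypothesis kappa_inj : forall m1 m2, m1 != m2 -> kappa m1 ^+ 2 != kappa m2 ^+ 2.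
Hypothesis w0 : forall m l, w m l != 0.
Hypothesis w_inj : forall m l1 l2, l1 != l2 -> w m l1 != w m l2.
Variable b : forall m : 'I_p.+1, 'I_(2 * m).+1 -> F.
Arguments b : clear implicits.

(** After multiplication by w^m the moments of order -m, ..., m become those of
    the polynomials of degree at most 2m, among them a Lagrange polynomial of
    the 2m + 1 distinct nodes. *)
Lemma trig_moments_inj (m : 'I_p.+1) :
  (forall n, (n <= m)%N -> \sum_l b m l * w m l ^+ n = 0 /\
                           \sum_l b m l * (w m l)^-1 ^+ n = 0) ->
  forall l, b m l = 0.
Proof.
move=> bm l.
have bX n : (n <= 2 * m)%N -> \sum_l b m l * (w m l) ^- m * w m l ^+ n = 0.
  move=> nm; have [mn|mn] := leqP m n.
    rewrite -[RHS](bm (n - m)%N _).1; last by lia.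
    apply: eq_bigr => i _; rewrite -[X in _ * _ ^+ X = _](subnK mn) exprD -!mulrA.
    congr (_ * _).
    by rewrite mulrCA mulVf ?mulr1// expf_neq0.
  rewrite -[RHS](bm (m - n)%N _).2; last by lia.
  apply: eq_bigr => i _; rewrite -[X in (_ ^+ X)^-1](subnK (ltnW mn)) exprD invfM.
  rewrite -!mulrA; congr (_ * _).
  by rewrite -[RHS]mulr1 exprVn; congr (_ * _); rewrite mulVf// expf_neq0.
have bP (r : {poly F}) : (size r <= (2 * m).+1)%N ->
    \sum_l b m l * (w m l) ^- m * r.[w m l] = 0.
  move=> sr; under eq_bigr do rewrite (horner_coef_wide _ sr) big_distrr/=.
  rewrite exchange_big big1//= => i _.
  under eq_bigr do rewrite mulrCA.
  by rewrite -big_distrr/= bX ?mulr0// -ltnS.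
pose r := \prod_(i | i != l) ('X - (w m i)%:P).
have sr : size r = (2 * m).+1.
  rewrite /r -big_filter size_prod_XsubC; congr _.+1.
  by rewrite -sum1_size big_filter sum1_card cardC1 card_ord.
have := bP r; rewrite sr => /(_ (leqnn _)) /eqP.
rewrite (bigD1 l)//= big1 ?addr0; last first.
  by move=> i il; rewrite /r horner_prod (bigD1 i)//= hornerXsubC subrr mul0r mulr0.
rewrite !mulf_eq0 invr_eq0 expf_eq0 (negbTE (w0 _)) andbF orbF => /orP[/eqP//|].
rewrite /r horner_prod => /prodf_eq0[i il].
by rewrite hornerXsubC subr_eq0 eq_sym (negbTE (w_inj il)).
Qed.

Hypothesis moments : forall n (q : {poly F}), (n + size q <= p.+1)%N ->
  \sum_m \sum_l b m l * (kappa m ^+ n * w m l ^+ n * q.[kappa m ^+ 2]) = 0 /\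
  \sum_m \sum_l b m l * (kappa m ^+ n * (w m l)^-1 ^+ n * q.[kappa m ^+ 2]) = 0.

(** Induction on the level: once the lower levels vanish, a Lagrange polynomial in
    kappa^2 of degree p - n isolates the moment of order n of a single level
    m >= n. *)
Lemma moments_inj m l : b m l = 0.
Proof.
suff H n : (n <= p)%N ->
    (forall m : 'I_p.+1, (n <= m)%N ->
      \sum_l b m l * w m l ^+ n = 0 /\ \sum_l b m l * (w m l)^-1 ^+ n = 0) /\
    (forall m : 'I_p.+1, m = n :> nat -> forall l, b m l = 0).
  by have [|_ /(_ m erefl l)] := H m; first by rewrite -ltnS.
elim/ltn_ind: n => n IH np.
have Pn (m' : 'I_p.+1) : (n <= m')%N ->
    \sum_l b m' l * w m' l ^+ n = 0 /\ \sum_l b m' l * (w m' l)^-1 ^+ n = 0.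
  move=> nm.
  pose q := \prod_(i : 'I_p.+1 | (n <= i)%N && (i != m')) ('X - (kappa i ^+ 2)%:P).
  have sq : (n + size q <= p.+1)%N.
    rewrite /q -big_filter size_prod_XsubC -sum1_size big_filter sum1_card.
    have : (#|[pred i : 'I_p.+1 | (n <= i)%N && (i != m')]| <
            #|[pred i : 'I_p.+1 | (n <= i)%N]|)%N.
      apply: proper_card; apply/properP; split.
        by apply/fintype.subsetP => i; rewrite !inE => /andP[].
      by exists m'; rewrite !inE ?eqxx ?andbF.
    have := cardC [pred i : 'I_p.+1 | (n <= i)%N]; rewrite card_ord.
    have -> : #|[predC [pred i : 'I_p.+1 | (n <= i)%N]]| = n.
      have nle : (n <= p.+1)%N by lia.
      have wi : injective (widen_ord nle) by move=> i j /(congr1 val)/= ij; exact: val_inj.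
      rewrite -[RHS](card_ord n) -[RHS](card_codom wi).
      apply: eq_card => i; rewrite !inE /= -ltnNge.
      apply/idP/codomP => [ni|[j ->]]; last exact: (valP j).
      by exists (Ordinal ni); exact: val_inj.
    move=> e lt; apply: (@leq_trans (#|[pred i : 'I_p.+1 | (n <= i)%N]| + n)%N).
      by rewrite addnC leq_add2r; apply: leq_ltn_trans lt; apply/eq_leq/eq_card.
    by rewrite e.
  have q0 (i : 'I_p.+1) : (n <= i)%N -> i != m' -> q.[kappa i ^+ 2] = 0.
    by move=> ni im; rewrite /q horner_prod (bigD1 i) ?ni//= hornerXsubC subrr mul0r.
  have qm : q.[kappa m' ^+ 2] != 0.
    rewrite /q horner_prod; apply/prodf_neq0 => i /andP[_ im].
    by rewrite hornerXsubC subr_eq0 kappa_inj// eq_sym.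
  have [H1 H2] := moments sq.
  have red (W : forall m : 'I_p.+1, 'I_(2 * m).+1 -> F) :
      \sum_m \sum_l b m l * (kappa m ^+ n * W m l * q.[kappa m ^+ 2]) = 0 ->
      \sum_l b m' l * W m' l = 0.
    rewrite (bigD1 m')//= [X in _ + X]big1 ?addr0; last first.
      move=> i im; apply: big1 => j _; have [ni|ni] := leqP n i.
        by rewrite q0// !mulr0.
      have [_ /(_ i erefl j) ->] := IH i ni (leq_trans (ltnW ni) np).
      by rewrite mul0r.
    have -> : \sum_l b m' l * (kappa m' ^+ n * W m' l * q.[kappa m' ^+ 2]) =
        kappa m' ^+ n * q.[kappa m' ^+ 2] * \sum_l b m' l * W m' l.
      by rewrite big_distrr/=; apply: eq_bigr => i _; ring.
    by move/eqP; rewrite !mulf_eq0 expf_eq0 (negbTE (kappa0 _)) (negbTE qm) andbF => /eqP.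
  by split; apply: (red (fun m l => _ ^+ n)).
split=> // m' m'n l'.
apply: trig_moments_inj => n' n'm.
have : (n' <= n)%N by rewrite -m'n.
rewrite leq_eqVlt => /orP[/eqP e|n'n].
  by rewrite e; apply: Pn; rewrite m'n.
by have [+ _] := IH n' n'n (leq_trans (ltnW n'n) np); apply.
Qed.

End Moments.

(** The multi-indices of order m with j_x <= 1 are numbered by l = 0, ..., 2m
    through j_x + 2 j_y = l, which leaves j_t = m - j_x - j_y.  Rows and columns
    of the matrix are thus indexed by the same type. *)
Definition row_index (s : wave_index) : multi_index :=
  let l := (tagged s : nat) in
  ((odd l : nat, (uphalf l - odd l)%N), (tag s - uphalf l)%N).

Lemma row_index_order s : mi_order (row_index s) = tag s.
Proof.
rewrite /mi_order/=; have : (tagged s < (2 * tag s).+1)%N by [].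
rewrite ltnS uphalf_half; lia.
Qed.

Lemma row_index_surj (jx jy jt : nat) : (jx <= 1)%N -> (jx + jy + jt <= p)%N ->
  exists s, row_index s = ((jx, jy), jt).
Proof.
move=> jx1 jp.
have mp : (jx + jy + jt < p.+1)%N by [].
have lm : (2 * jy + jx < (2 * (jx + jy + jt)).+1)%N by lia.
exists (Tagged (fun m : 'I_p.+1 => 'I_(2 * m).+1)
  (Ordinal lm : 'I_(2 * (Ordinal mp : 'I_p.+1)).+1)).
rewrite /row_index /= uphalf_half; congr (_, _, _); lia.
Qed.

Section Jets.
Variables (iF v : F) (kappa : 'I_p.+1 -> F).
Variables (w X Y S : wave_index -> F).
Hypothesis kappa0 : forall m, kappa m != 0.
Hypothesis kappa_inj : forall m1 m2, m1 != m2 -> kappa m1 ^+ 2 != kappa m2 ^+ 2.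
Hypothesis w0 : forall s, w s != 0.
Hypothesis w_inj : forall (m : 'I_p.+1) (l1 l2 : 'I_(2 * m).+1), l1 != l2 ->
  w (Tagged _ l1) != w (Tagged _ l2).
Hypothesis iF2 : iF ^+ 2 = -1.
Hypothesis XYw : forall s, X s + iF * Y s = kappa (tag s) * w s.
Hypothesis XYwV : forall s, X s - iF * Y s = kappa (tag s) * (w s)^-1.
Hypothesis kappaS : forall s, kappa (tag s) ^+ 2 = v - iF * S s.

(** The symbol of D^j at the plane wave s, that is D^j phi / phi. *)
Definition jet (s : wave_index) (j : multi_index) : F :=
  X s ^+ j.1.1 * Y s ^+ j.1.2 * S s ^+ j.2.

Lemma sqr_X s : X s ^+ 2 = v - iF * S s - Y s ^+ 2.
Proof.
rewrite -kappaS; transitivity ((X s + iF * Y s) * (X s - iF * Y s) - Y s ^+ 2).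
  by rewrite mulrC -subr_sqr exprMn iF2; ring.
by rewrite XYw XYwV; field; exact: w0.
Qed.

Lemma jet_schroedinger s jx jy jt :
  jet s ((jx.+2, jy), jt) = - jet s ((jx, jy.+2), jt) +
    (v * jet s ((jx, jy), jt) - iF * jet s ((jx, jy), jt.+1)).
Proof.
rewrite /jet /=; have -> : X s ^+ jx.+2 = X s ^+ jx * X s ^+ 2 by rewrite -exprD addn2.
have -> : Y s ^+ jy.+2 = Y s ^+ jy * Y s ^+ 2 by rewrite -exprD addn2.
by rewrite sqr_X [S s ^+ jt.+1]exprS; ring.
Qed.

(** A kernel vector is propagated from the rows to all monomials of degree at most
    p (bj), then to (X + eY)^n times monomials (bXY), to powers of kappa^2, which
    is affine in S (bS), and to polynomials in kappa^2 (bq); e = iF and e = - iF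
    give the moments. *)
Lemma jet_injective (b : wave_index -> F) :
  (forall s', \sum_s b s * jet s (row_index s') = 0) -> forall s, b s = 0.
Proof.
move=> b0.
have bj jx : forall jy jt, (jx + jy + jt <= p)%N ->
    \sum_s b s * jet s ((jx, jy), jt) = 0.
  elim/ltn_ind: jx => -[|[|jx]] IH jy jt jp.
  - by have [s' e] := row_index_surj (leq0n 1) jp; rewrite -e.
  - by have [s' e] := row_index_surj (leqnn 1) jp; rewrite -e.
  - under eq_bigr do rewrite jet_schroedinger mulrDr mulrBr mulrN (mulrCA _ v) (mulrCA _ iF).
    rewrite big_split/= sumrB sumrN -!big_distrr/= !IH ?mulr0 ?subrr ?addr0 ?oppr0//; lia.
have bXY (e : F) n : forall jx jy jt, (n + jx + jy + jt <= p)%N ->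
    \sum_s b s * ((X s + e * Y s) ^+ n * jet s ((jx, jy), jt)) = 0.
  elim: n => [|n IH] jx jy jt jp.
    by under eq_bigr do rewrite expr0 mul1r; exact: bj.
  have -> : \sum_s b s * ((X s + e * Y s) ^+ n.+1 * jet s ((jx, jy), jt)) =
      \sum_s b s * ((X s + e * Y s) ^+ n * jet s ((jx.+1, jy), jt)) +
      e * \sum_s b s * ((X s + e * Y s) ^+ n * jet s ((jx, jy.+1), jt)).
    rewrite big_distrr -big_split/=; apply: eq_bigr => s _.
    by rewrite /jet/= !exprS; ring.
  by rewrite !IH ?mulr0 ?addr0//; lia.
have bS (e : F) n d : forall jt, (n + d + jt <= p)%N ->
    \sum_s b s * ((X s + e * Y s) ^+ n * (kappa (tag s) ^+ 2) ^+ d * S s ^+ jt) = 0.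
  elim: d => [|d IH] jt jp.
    rewrite -[RHS](bXY e n 0%N 0%N jt); last by lia.
    by apply: eq_bigr => s _; rewrite /jet/= !expr0 !mul1r mulr1.
  have -> : \sum_s b s * ((X s + e * Y s) ^+ n * (kappa (tag s) ^+ 2) ^+ d.+1 * S s ^+ jt) =
      v * \sum_s b s * ((X s + e * Y s) ^+ n * (kappa (tag s) ^+ 2) ^+ d * S s ^+ jt) -
      iF * \sum_s b s * ((X s + e * Y s) ^+ n * (kappa (tag s) ^+ 2) ^+ d * S s ^+ jt.+1).
    rewrite !big_distrr -sumrB/=; apply: eq_bigr => s _.
    by rewrite exprSr kappaS [S s ^+ jt.+1]exprS; ring.
  by rewrite !IH ?mulr0 ?subr0//; lia.
have bq (e : F) n (q : {poly F}) : (n + size q <= p.+1)%N ->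
    \sum_s b s * ((X s + e * Y s) ^+ n * q.[kappa (tag s) ^+ 2]) = 0.
  move=> nq; under eq_bigr do rewrite horner_coef !big_distrr/=.
  rewrite exchange_big big1//= => d _.
  transitivity (q`_d * \sum_s b s *
      ((X s + e * Y s) ^+ n * (kappa (tag s) ^+ 2) ^+ d * S s ^+ 0)).
    by rewrite big_distrr; apply: eq_bigr => s _; rewrite expr0 /=; ring.
  have dq : (d < size q)%N by exact: ltn_ord.
  rewrite bS ?mulr0// addn0 -ltnS (leq_trans _ nq)// -addnS leq_add2l.
  exact: dq.
move=> [m l].
apply: (@moments_inj kappa (fun m l => w (Tagged _ l)) _ _ _ _
  (fun m l => b (Tagged (fun m : 'I_p.+1 => 'I_(2 * m).+1) l))) => //.
move=> n q nq; split.
  rewrite sig_big_dep/= -[RHS](bq iF n q nq).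
  by apply: eq_bigr => -[m' l'] _; rewrite XYw exprMn.
rewrite sig_big_dep/= -[RHS](bq (- iF) n q nq).
by apply: eq_bigr => -[m' l'] _; rewrite mulNr XYwV exprMn.
Qed.

(** The inverse matrix, which expresses any values prescribed on the rows by the
    jets of the waves. *)
Lemma jet_dual : exists N : wave_index -> wave_index -> F,
  forall (c : wave_index -> F) s',
    c s' = \sum_s (\sum_s'' N s s'' * c s'') * jet s (row_index s').
Proof.
pose M : 'M[F]_#|{: wave_index}| := \matrix_(i, j) jet (enum_val i) (row_index (enum_val j)).
have sumE (f : wave_index -> F) : \sum_s f s = \sum_(i < #|{: wave_index}|) f (enum_val i).
  rewrite (reindex_onto enum_val enum_rank)//=; last by move=> s _; rewrite enum_rankK.
  by apply: eq_bigl => i; rewrite enum_valK eqxx.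
have Mu : M \in unitmx.
  rewrite -row_free_unit; apply: inj_row_free => u uM; apply/rowP => i.
  rewrite mxE -(enum_valK i).
  apply: (@jet_injective (fun s => u 0 (enum_rank s))) => s'.
  rewrite sumE; move/rowP: uM => /(_ (enum_rank s')); rewrite !mxE => e; rewrite -[RHS]e.
  by apply: eq_bigr => j _; rewrite mxE !enum_valK enum_rankK.
exists (fun s s'' => invmx M (enum_rank s'') (enum_rank s)) => c s'.
pose cv : 'rV[F]_#|{: wave_index}| := \row_j c (enum_val j).
have /rowP/(_ (enum_rank s')) : (cv *m invmx M) *m M = cv by rewrite mulmxKV.
rewrite [RHS]mxE enum_rankK => <-; rewrite sumE mxE; apply: eq_bigr => i _.
rewrite [M _ _]mxE enum_rankK enum_valK; congr (_ * _).
by rewrite sumE mxE; apply: eq_bigr => j _; rewrite mxE enum_valK mulrC.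
Qed.

End Jets.
End Unisolvence.

(** * Derivatives of plane waves *)

Section PlaneWaveJets.
Context {R : realType}.
Variables (k theta v : R).

Let A := k * cos theta.
Let B := k * sin theta.
Let C := - (k ^+ 2 + v).

Let phase (z : spacetime R) : R := A * z.1.1 + B * z.1.2 + C * z.2.
Let E (z : spacetime R) : R[i] := cos (phase z) +i* sin (phase z).

Let is_diff_phase z : is_diff z phase phase.
Proof.
have dX := is_diffZ A (is_diff_linear z (@coord_x_continuous R)).
have dY := is_diffZ B (is_diff_linear z (@coord_y_continuous R)).
have dS := is_diffZ C (is_diff_linear z (@coord_t_continuous R)).
exact: is_diffD (is_diffD dX dY) dS.
Qed.

Lemma plane_waveE z : plane_wave k theta v z = E z.
Proof.
rewrite /plane_wave /expC /E /= !mul0r !mul1r !subrr expR0 add0r.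
rewrite (_ : _ - _ = phase z); last by rewrite /phase /A /B /C; ring.
by apply/eqP; rewrite eq_complex/= !mul1r !mul0r subr0 addr0 !eqxx.
Qed.

Lemma normc_plane_wave z : normc (plane_wave k theta v z) = 1.
Proof. by rewrite plane_waveE normcE/= cos2Dsin2 sqrtr1. Qed.

(** Real and imaginary parts of a plane wave are both of this form, and
    differentiation only changes the amplitude al. *)
Let wave (al : R[i]) (z : spacetime R) : R := complex.Re (al * E z).

Let derive_wave al u z : 'D_u (wave al) z = wave (al * (0 +i* phase u)) z.
Proof.
have -> : wave al = (complex.Re al \*: (fun z => cos (phase z)))
    - (complex.Im al \*: (fun z => sin (phase z))).
  by apply/funext => y; rewrite /wave complex_ReM.
have dc : differentiable (@cos R) (phase z) by exact/derivable1_diffP.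
have ds : differentiable (@sin R) (phase z) by exact/derivable1_diffP.
have dcp : derivable (fun z => cos (phase z)) z u.
  apply: diff_derivable; apply: (@differentiable_comp _ _ _ _ phase cos) => //.
  by have [] := is_diff_phase z.
have dsp : derivable (fun z => sin (phase z)) z u.
  apply: diff_derivable; apply: (@differentiable_comp _ _ _ _ phase sin) => //.
  by have [] := is_diff_phase z.
rewrite deriveB; [|exact: derivableZ..].
rewrite !deriveZ//.
rewrite (derive_comp_diff u (is_diff_phase z) dc) (derive_comp_diff u (is_diff_phase z) ds).
rewrite !derive1E !derive_val /wave /GRing.scale/= !complex_ReM !complex_ImM/=.
by ring.
Qed.

Let Dseq_nseq_wave n al u : Dseq (nseq n u) (wave al) =
  wave (al * (0 +i* phase u) ^+ n).
Proof.
elim: n al => [|n IH] al /=; first by rewrite expr0 mulr1.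
rewrite IH; apply/funext => z; rewrite derive_wave.
by rewrite -mulrA -exprSr.
Qed.

Lemma CDmi_plane_wave (j : multi_index) z :
  CDmi j (plane_wave k theta v) z =
  (0 +i* A) ^+ j.1.1 * (0 +i* B) ^+ j.1.2 * (0 +i* C) ^+ j.2 *
  plane_wave k theta v z.
Proof.
have D al : Dmi j (wave al) z =
    wave (al * ((0 +i* A) ^+ j.1.1 * (0 +i* B) ^+ j.1.2 * (0 +i* C) ^+ j.2)) z.
  rewrite /Dmi /Dseq !foldr_cat -!/(Dseq _ _) !Dseq_nseq_wave.
  have -> : phase (1, 0, 0) = A by rewrite /phase/=; ring.
  have -> : phase (0, 1, 0) = B by rewrite /phase/=; ring.
  have -> : phase (0, 0, 1) = C by rewrite /phase/=; ring.
  by congr wave; ring.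
rewrite /CDmi.
have -> : (fun y => complex.Re (plane_wave k theta v y)) = wave 1.
  by apply/funext => y; rewrite plane_waveE /wave mul1r.
have -> : (fun y => complex.Im (plane_wave k theta v y)) = wave (0 -i* 1).
  by apply/funext => y; rewrite plane_waveE /wave complex_ReM/=; ring.
rewrite !D plane_waveE mul1r; set be := _ * _ * _.
apply/eqP; rewrite eq_complex /=; apply/andP; split; apply/eqP => //.
by rewrite /wave -mulrA !complex_ReM !complex_ImM/=; ring.
Qed.

End PlaneWaveJets.

(** * Integral and norm estimates *)

Section Angles.
Context {R : realType}.

Lemma cos_eq1_lt2pi (x : R) : `|x| < 2 * pi -> cos x = 1 -> x = 0.
Proof.
wlog x0 : x / 0 <= x.
  move=> H xpi cx; have [x0|/ltW x0] := leP 0 x; first exact: H.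
  by apply/eqP; rewrite -oppr_eq0; apply/eqP/H; rewrite ?oppr_ge0 ?normrN ?cosN.
rewrite ger0_norm// => xpi cx; apply/eqP; rewrite eq_le x0 andbT leNgt.
apply/negP => xgt0.
have : 0 < sin (x / 2) by apply: sin_gt0_pi; apply/andP; split; lra.
have : cos (x / 2 + x / 2) = 1 by rewrite -splitr.
rewrite cosD -!expr2 cos2sin2 => h s0.
have : sin (x / 2) ^+ 2 = 0 by lra.
by move/eqP; rewrite sqrf_eq0 gt_eqF.
Qed.

Lemma angle_inj (x y : R) : 0 <= x < 2 * pi -> 0 <= y < 2 * pi ->
  cos x = cos y -> sin x = sin y -> x = y.
Proof.
move=> /andP[x0 x1] /andP[y0 y1] cxy sxy; apply/eqP; rewrite -subr_eq0; apply/eqP.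
apply: cos_eq1_lt2pi; first by rewrite ltr_norml; apply/andP; split; lra.
by rewrite cosB cxy sxy -!expr2 cos2Dsin2.
Qed.

End Angles.

Section Integrals.
Context (R : realType) (d : measure_display) (T : measurableType d).
Variable mu : {measure set T -> \bar R}.
Implicit Types (D : set T).

Lemma integrable_sumr D (I : Type) (r : seq I) (f : I -> T -> R) :
  measurable D -> (forall i, mu.-integrable D (EFin \o f i)) ->
  mu.-integrable D (EFin \o (fun x => \sum_(i <- r) f i x)).
Proof.
move=> mD fi.
rewrite (_ : _ \o _ = (fun x => \sum_(i <- r) (f i x)%:E)%E); last first.
  by apply/funext => x; rewrite /= sumEFin.
by apply: integrable_sum => // i _; exact: fi.
Qed.

Lemma Rintegral_sum D (I : Type) (r : seq I) (f : I -> T -> R) :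
  measurable D -> (forall i, mu.-integrable D (EFin \o f i)) ->
  \int[mu]_(x in D) (\sum_(i <- r) f i x) =
  \sum_(i <- r) \int[mu]_(x in D) f i x.
Proof.
move=> mD fi; elim: r => [|i r IH].
  by under eq_Rintegral do rewrite big_nil; rewrite big_nil Rintegral_cst// mul0r.
under eq_Rintegral do rewrite big_cons.
by rewrite big_cons -IH RintegralD//; exact: integrable_sumr.
Qed.

Lemma ge0_subset_Rintegral D E (f : T -> R) : measurable D -> measurable E ->
  D `<=` E -> mu.-integrable E (EFin \o f) -> (forall x, E x -> 0 <= f x) ->
  \int[mu]_(x in D) f x <= \int[mu]_(x in E) f x.
Proof.
move=> mD mE DE fi f0; apply: fine_le.
- by apply: integrable_fin_num => //; exact: integrableS mE mD DE fi.
- exact: integrable_fin_num.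
- apply: ge0_subset_integral => //; first by case/integrableP: fi.
Qed.

(** The Cauchy-Schwarz inequality against a constant: the integral of (f - c)^2 is
    a nonnegative quadratic polynomial in c. *)
Lemma cauchy_schwarz_cst D (f : T -> R) : measurable D -> (mu D < +oo)%E ->
  mu.-integrable D (EFin \o f) ->
  mu.-integrable D (fun x => (f x ^+ 2)%:E) ->
  \int[mu]_(x in D) f x <=
  Num.sqrt (fine (mu D)) * Num.sqrt (\int[mu]_(x in D) (f x ^+ 2)).
Proof.
move=> mD Doo fi f2i.
set A := fine _; set J := \int[_]_(_ in _) _; set Q := \int[_]_(_ in _) _.
have A0 : 0 <= A by rewrite fine_ge0.
have Q0 : 0 <= Q by apply: Rintegral_ge0 => x _; rewrite sqr_ge0.
have poly c : 0 <= Q - 2 * c * J + c ^+ 2 * A.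
  have ci : mu.-integrable D (EFin \o cst (c ^+ 2)).
    apply: measurable_bounded_integrable => //.
    exists (`|c ^+ 2|); split; first exact: num_real.
    by move=> N N1 x _; rewrite /= ltW.
  have cfi : mu.-integrable D (EFin \o (fun x => 2 * c * f x)).
    exact: (@integrableZl _ _ _ mu D mD _ _ fi).
  have -> : Q - 2 * c * J + c ^+ 2 * A =
      \int[mu]_(x in D) ((f x ^+ 2 - 2 * c * f x) + cst (c ^+ 2) x).
    rewrite RintegralD//; last exact: (integrableB mD f2i cfi).
    by rewrite RintegralB// RintegralZl// Rintegral_cst.
  apply: Rintegral_ge0 => x _ /=.
  by have := sqr_ge0 (f x - c); rewrite sqrrB; lra.
(* The minimum of the polynomial is at c = J / A; for A = 0 it is affine in c,
   and c = (Q + 1) / (2 J) makes it negative unless J = 0. *)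
have JAQ : J ^+ 2 <= A * Q.
  have [A00|An0] := eqVneq A 0.
    have [->|Jn0] := eqVneq J 0; first by rewrite expr0n/= mulr_ge0.
    have := poly ((Q + 1) / (2 * J)); rewrite A00 mulr0 addr0.
    have -> : 2 * ((Q + 1) / (2 * J)) * J = Q + 1 by field.
    by lra.
  have := poly (J / A).
  have -> : Q - 2 * (J / A) * J + (J / A) ^+ 2 * A = (A * Q - J ^+ 2) / A by field.
  by rewrite pmulr_lge0 ?invr_gt0 ?lt_def ?An0// subr_ge0.
rewrite -sqrtrM// (le_trans (ler_norm _))// -sqrtr_sqr ler_sqrt//.
by rewrite mulr_ge0.
Qed.

Implicit Types (f g : T -> R[i]).

Lemma in_L1_sum D (I : Type) (r : seq I) (f : I -> T -> R[i]) : measurable D ->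
  (forall i, in_L1 mu D (f i)) -> in_L1 mu D (fun x => \sum_(i <- r) f i x).
Proof.
move=> mD fi; elim: r => [|i r IH].
  by under eq_fun do rewrite big_nil; split; exact: integrable0.
by under eq_fun do rewrite big_cons; exact: in_L1D.
Qed.

Lemma in_L1_normc D f : measurable D -> in_L1 mu D f ->
  mu.-integrable D (EFin \o (fun x => normc (f x))).
Proof.
move=> mD [f1 f2].
have /integrableP[m1 _] := f1; have /integrableP[m2 _] := f2.
have := integrableD mD (integrable_abse f1) (integrable_abse f2).
apply: le_integrable => //.
  by apply/measurable_EFinP; apply: measurable_normc; exact/measurable_EFinP.
move=> x _ /=; rewrite lee_fin normcE ger0_norm ?sqrtr_ge0//.
rewrite [leRHS]ger0_norm; last by rewrite addr_ge0.
rewrite -[leRHS]ger0_norm; last by rewrite addr_ge0.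
rewrite -sqrtr_sqr ler_sqrt ?sqr_ge0// sqrrD !real_normK ?num_real//.
have := mulr_ge0 (normr_ge0 (complex.Re (f x))) (normr_ge0 (complex.Im (f x))).
by lra.
Qed.

End Integrals.

Section Norms.
Context {R : realType}.
Notation mR := (measurableTypeR R).

Lemma le_sobolev_norm (q : nat) (K : set (spacetime R)) (psi : spacetime R -> R[i])
    (j : multi_index) : (mi_order j <= q)%N ->
  Num.sqrt (\int[@leb3 R]_(z in K) (normc (weakD K j psi z) ^+ 2)) <=
  sobolev_norm q K psi.
Proof.
case: j => -[jx jy] jt; rewrite /mi_order/= => jq.
pose G (a b c : nat) := \int[@leb3 R]_(z in K) (normc (weakD K ((a, b), c) psi z) ^+ 2).
have G0 a b c : 0 <= G a b c by apply: Rintegral_ge0 => z _; rewrite sqr_ge0.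
have xq : (jx < q.+1)%N by lia.
have yq : (jy < q.+1)%N by lia.
have tq : (jt < q.+1)%N by lia.
rewrite /sobolev_norm ler_sqrt; last first.
  by do 3 (apply: sumr_ge0 => ? _); exact: G0.
rewrite (bigD1 (Ordinal xq))//= (bigD1 (Ordinal yq))//= (bigD1 (Ordinal tq))//=.
rewrite -!addrA lerDl !addr_ge0//.
- by apply: sumr_ge0 => ? _; exact: G0.
- by do 2 (apply: sumr_ge0 => ? _); exact: G0.
- by do 3 (apply: sumr_ge0 => ? _); exact: G0.
Qed.

Lemma measurable_euclidean_ball (c : spacetime R) r :
  measurable (euclidean_ball c r : set (mR * mR * mR)%type).
Proof.
have mX := @measurable_coord_x R; have mY := @measurable_coord_y R.
have mT := @measurable_coord_t R.
have mf : measurable_fun [set: (mR * mR * mR)%type] (fun z : mR * mR * mR =>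
    (z.1.1 - c.1.1) ^+ 2 + (z.1.2 - c.1.2) ^+ 2 + (z.2 - c.2) ^+ 2 : R).
  apply: measurable_funD; first apply: measurable_funD.
  - by apply: measurable_funX; apply: measurable_funB.
  - by apply: measurable_funX; apply: measurable_funB.
  - by apply: measurable_funX; apply: measurable_funB.
rewrite (_ : euclidean_ball c r = (fun z : mR * mR * mR =>
    (z.1.1 - c.1.1) ^+ 2 + (z.1.2 - c.1.2) ^+ 2 + (z.2 - c.2) ^+ 2 : R) @^-1`
      `]-oo, r ^+ 2[%classic).
  by rewrite -[X in measurable X]setTI; apply: mf => //; exact: measurable_itv.
by apply/seteqP; split => z; rewrite /= in_itv.
Qed.

(** The inverse of the plane wave, which has modulus one; as a conjugate it has
    visibly measurable and bounded parts. *)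
Definition conj_wave (k theta v : R) (z : spacetime R) : R[i] :=
  (complex.Re (plane_wave k theta v z))%:C -
  'i%C * (complex.Im (plane_wave k theta v z))%:C.

Lemma conj_wave_mul k theta v z : conj_wave k theta v z * plane_wave k theta v z = 1.
Proof.
have := sqr_normc (plane_wave k theta v z); rewrite normc_plane_wave expr1n.
rewrite /conj_wave; case: plane_wave => x y /= e.
by apply/eqP; rewrite eq_complex/=; apply/andP; split; apply/eqP; [rewrite [RHS]e|]; ring.
Qed.

Lemma normc_conj_wave k theta v z : normc (conj_wave k theta v z) = 1.
Proof.
have := normc_plane_wave k theta v z; rewrite /conj_wave !normcE.
case: plane_wave => x y /= e; rewrite -[RHS]e; congr Num.sqrt; ring.
Qed.

Lemma measurable_plane_wave k theta v :
  measurable_fun [set: (mR * mR * mR)%type] (fun z => complex.Re (plane_wave k theta v z)) /\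
  measurable_fun [set: (mR * mR * mR)%type] (fun z => complex.Im (plane_wave k theta v z)).
Proof.
have mX := @measurable_coord_x R; have mY := @measurable_coord_y R.
have mT := @measurable_coord_t R.
have mp : measurable_fun [set: (mR * mR * mR)%type] (fun z : mR * mR * mR =>
    k * cos theta * z.1.1 + k * sin theta * z.1.2 + - (k ^+ 2 + v) * z.2 : R).
  apply: measurable_funD; first apply: measurable_funD.
  - by apply: measurable_funM.
  - by apply: measurable_funM.
  - by apply: measurable_funM.
under eq_fun do rewrite plane_waveE/=.
split.
  exact: (measurableT_comp (continuous_measurable_fun (@continuous_cos R)) mp).
under eq_fun do rewrite plane_waveE/=.
exact: (measurableT_comp (continuous_measurable_fun (@continuous_sin R)) mp).
Qed.

Lemma in_L1_conj_wave D k theta v f : measurable (D : set (mR * mR * mR)%type) ->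
  in_L1 (@leb3 R) D f -> in_L1 (@leb3 R) D (fun z => conj_wave k theta v z * f z).
Proof.
move=> mD fi; have [mr mi] := measurable_plane_wave k theta v.
have Re1 z : `|complex.Re (plane_wave k theta v z)| <= 1.
  by rewrite -(normc_plane_wave k theta v z) Re_le_normc.
have Im1 z : `|complex.Im (plane_wave k theta v z)| <= 1.
  by rewrite -(normc_plane_wave k theta v z) Im_le_normc.
have h1 := in_L1_mulr mD fi (measurable_funTS mr) Re1.
have h2 := in_L1_mulr mD fi (measurable_funTS mi) Im1.
have := in_L1D mD h1 (in_L1Z (- 'i%C) mD h2).
by congr in_L1; apply/funext => z; rewrite /conj_wave; ring.
Qed.

End Norms.

(** * Local coefficients in the plane-wave basis *)

Section Coefficients.
Context {R : realType}.
Variables (p : nat) (k : 'I_p.+1 -> R).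
Hypothesis hk0 : forall m, k m != 0.
Hypothesis hk : forall m1 m2 : 'I_p.+1, m1 != m2 -> k m1 ^+ 2 != k m2 ^+ 2.
Variable theta : forall m : 'I_p.+1, 'I_(2 * m).+1 -> R.
Arguments theta : clear implicits.
Hypothesis theta_range : forall m l, 0 <= theta m l < 2 * pi.
Hypothesis theta_inj : forall (m : 'I_p.+1) (l1 l2 : 'I_(2 * m).+1),
  l1 != l2 -> theta m l1 != theta m l2.
Variable v : R.

Let W := wave_index p.
Let kW (s : W) := k (tag s).
Let thetaW (s : W) := theta (tag s) (tagged s).

Definition wave_jet : W -> multi_index -> R[i] :=
  jet (fun s => 0 +i* (kW s * cos (thetaW s)))
      (fun s => 0 +i* (kW s * sin (thetaW s)))
      (fun s => 0 +i* (- (kW s ^+ 2 + v))).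

(* In the notation of jet_dual, X + iY and X - iY factor as kappa w and
   kappa / w with kappa = i k and w = exp (i theta). *)
Let iC : R[i] := 0 +i* 1.
Let kappa (m : 'I_p.+1) : R[i] := 0 +i* k m.
Let w (s : W) : R[i] := cos (thetaW s) +i* sin (thetaW s).

Let w_inv s : w s * (cos (thetaW s) -i* sin (thetaW s)) = 1.
Proof.
apply/eqP; rewrite eq_complex/=; apply/andP; split; apply/eqP.
  by rewrite -[RHS](cos2Dsin2 (thetaW s)); ring.
by ring.
Qed.

Let w0 s : w s != 0.
Proof.
by apply/eqP => w0; have := w_inv s; rewrite w0 mul0r => /esym/eqP; rewrite oner_eq0.
Qed.

Let wV s : (w s)^-1 = cos (thetaW s) -i* sin (thetaW s).
Proof. by rewrite -[LHS]mulr1 -(w_inv s) mulKf. Qed.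

Let kappa0 m : kappa m != 0.
Proof. by rewrite eq_complex/= (negbTE (hk0 m)) andbF. Qed.

Let kappaE m : kappa m ^+ 2 = (- (k m ^+ 2))%:C.
Proof.
by apply/eqP; rewrite expr2 eq_complex/=; apply/andP; split; apply/eqP; ring.
Qed.

Let kappa_inj m1 m2 : m1 != m2 -> kappa m1 ^+ 2 != kappa m2 ^+ 2.
Proof. by move=> /hk; rewrite !kappaE eq_complex/= eqxx andbT eqr_opp. Qed.

Let w_inj (m : 'I_p.+1) (l1 l2 : 'I_(2 * m).+1) : l1 != l2 ->
  w (Tagged _ l1) != w (Tagged _ l2).
Proof.
move=> l12; rewrite eq_complex/=; apply/negP => /andP[/eqP c /eqP s].
by have := theta_inj l12; rewrite (angle_inj (theta_range l1) (theta_range l2) c s) eqxx.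
Qed.

Let iC2 : iC ^+ 2 = -1.
Proof.
by apply/eqP; rewrite expr2 eq_complex/=; apply/andP; split; apply/eqP; ring.
Qed.

Let XYw s : (0 +i* (kW s * cos (thetaW s))) + iC * (0 +i* (kW s * sin (thetaW s)))
  = kappa (tag s) * w s.
Proof.
apply/eqP; rewrite eq_complex/=; apply/andP.
by split; apply/eqP; rewrite /kW; ring.
Qed.

Let XYwV s : (0 +i* (kW s * cos (thetaW s))) - iC * (0 +i* (kW s * sin (thetaW s)))
  = kappa (tag s) * (w s)^-1.
Proof.
rewrite wV; apply/eqP; rewrite eq_complex/=; apply/andP.
by split; apply/eqP; rewrite /kW; ring.
Qed.

Let kappaS s : kappa (tag s) ^+ 2 = v%:C - iC * (0 +i* (- (kW s ^+ 2 + v))).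
Proof.
rewrite kappaE; apply/eqP; rewrite eq_complex/=; apply/andP.
by split; apply/eqP; rewrite /kW; ring.
Qed.

Lemma wave_jet_dual : exists N : W -> W -> R[i], forall (c : W -> R[i]) s',
  c s' = \sum_s (\sum_s'' N s s'' * c s'') * wave_jet s (row_index s').
Proof. exact: jet_dual kappa0 kappa_inj w0 w_inj iC2 XYw XYwV kappaS. Qed.

Lemma wave_jet_schroedinger s jx jy jt :
  wave_jet s ((jx.+2, jy), jt) = - wave_jet s ((jx, jy.+2), jt) +
    (v%:C * wave_jet s ((jx, jy), jt) - 'i%C * wave_jet s ((jx, jy), jt.+1)).
Proof. exact: jet_schroedinger w0 iC2 XYw XYwV kappaS _ _ _ _. Qed.

Lemma CDmi_wave_jet s j z :
  CDmi j (plane_wave (kW s) (thetaW s) v) z =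
  wave_jet s j * plane_wave (kW s) (thetaW s) v z.
Proof. exact: CDmi_plane_wave. Qed.

End Coefficients.

Theorem proposition4p9 (R : realType) (p : nat) (hp : (1 <= p)%N)
  (k : 'I_p.+1 -> R)
  (hk0 : forall m, k m != 0)
  (hk : forall m1 m2 : 'I_p.+1, m1 != m2 -> k m1 ^+ 2 != k m2 ^+ 2)
  (theta : forall m : 'I_p.+1, 'I_(2 * m).+1 -> R)
  (htheta_range : forall m l, 0 <= theta m l < 2 * pi)
  (htheta : forall (m : 'I_p.+1) (l1 l2 : 'I_(2 * m).+1), l1 != l2 -> theta m l1 != theta m l2)
  (v : R) :
  exists Cstar : R, 0 < Cstar /\
  forall (P : set (plane R)) (ta tb : R) (V : spacetime R -> R)
         (c : spacetime R) (r : R),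
    let K := P `*` `]ta, tb[%classic in
    let B := euclidean_ball c r in
    is_polygon P -> ta < tb ->
    (forall z, K z -> V z = v) ->
    0 < r -> B `<=` K -> star_shaped K B ->
    forall psi : spacetime R -> R[i],
      trefftz_space P `]ta, tb[%classic V psi ->
      in_sobolev p.+1 K psi ->
      exists a : forall m : 'I_p.+1, 'I_(2 * m).+1 -> spacetime R -> R[i],
        [/\ forall m l, in_L1 (@leb3 R) B (a m l),
            forall j : multi_index, (mi_order j <= p)%N ->
              {ae @leb3 R, forall z, B z ->
                weakD K j psi z =
                \sum_(m < p.+1) \sum_(l < (2 * m).+1)
                  a m l z * CDmi j (plane_wave (k m) (theta m l) v) z} &
            \int[@leb3 R]_(z in B)
              (\sum_(m < p.+1) \sum_(l < (2 * m).+1) normc (a m l z))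
            <= Cstar * Num.sqrt (fine (@leb3 R K)) * sobolev_norm p.+1 K psi].
Proof.
have [N Ninv] := wave_jet_dual hk0 hk htheta_range htheta v.
pose W := wave_index p.
pose nN (s'' : W) : R := \sum_(s : W) normc (N s s'').
exists (1 + \sum_s'' nN s''); split.
  rewrite ltr_wpDr//; apply: sumr_ge0 => s'' _; apply: sumr_ge0 => s _.
  by rewrite normcE sqrtr_ge0.
move=> P ta tb V c r K B [oP _ _ bP _] _ Vv _ BK _ psi trefftz_psi sobolev_psi.
have mP := open_measurable2 oP.
pose mR := measurableTypeR R.
have mI : measurable (`]ta, tb[%classic : set mR) by exact: measurable_itv.
have mK : measurable (K : set (mR * mR * mR)%type).
  exact: measurableX.
have mB := measurable_euclidean_ball c r.
have Koo := leb3_cylinder_lty ta tb oP bP.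
pose D (s : W) := weakD K (row_index s) psi.
have ordW (s : W) : (mi_order (row_index s) <= p.+1)%N.
  by rewrite row_index_order; apply: ltnW; exact: ltn_ord.
have DL1 s : in_L1 (@leb3 R) K (D s) by exact: (weakD_L1 oP bP sobolev_psi).
have DL1B s : in_L1 (@leb3 R) B (D s) by exact: in_L1S mK mB BK (DL1 s).
pose A (s : W) z := \sum_s'' N s s'' * D s'' z.
have AL1 s : in_L1 (@leb3 R) B (A s).
  by apply: in_L1_sum => // s''; exact: in_L1Z.
pose a (m : 'I_p.+1) (l : 'I_(2 * m).+1) z :=
  conj_wave (k m) (theta m l) v z * A (Tagged _ l) z.
exists a; split.
- by move=> m l; exact: in_L1_conj_wave.
(* The inverse matrix settles j_x <= 1; the equation reduces j_x by two and is
   satisfied by psi almost everywhere and by the waves. *)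
- move=> j jp.
  suff : {ae @leb3 R, forall z, K z ->
      weakD K j psi z = \sum_(s : W) A s z * wave_jet k theta v s j}.
    apply: filterS => z + Bz => /(_ (BK z Bz)) ->.
    rewrite sig_big_dep/=; apply: eq_bigr => -[m l] _ /=.
    have := CDmi_wave_jet k theta v (Tagged _ l) j z => /= ->.
    rewrite /a -[LHS]mulr1 -(conj_wave_mul (k m) (theta m l) v z); ring.
  case: j jp => -[jx jy] jt; rewrite /mi_order/=.
  elim/ltn_ind: jx jy jt => jx IH jy jt jp.
  have [jx1|jx1] := leqP jx 1.
    have [s' e] := row_index_surj jx1 jp; rewrite -e.
    by apply: aeW => z _; exact: (Ninv (fun s => D s z) s').
  case: jx => [|[|jx]] // in IH jp jx1 *.
  have h1 := @weakD_schroedinger _ _ _ _ oP bP _ _ _ _ Vv trefftz_psi sobolev_psi jx jy jt.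
  have {}h1 := h1 ltac:(lia).
  have h2 := IH jx ltac:(lia) jy.+2 jt ltac:(lia).
  have h3 := IH jx ltac:(lia) jy jt ltac:(lia).
  have h4 := IH jx ltac:(lia) jy jt.+1 ltac:(lia).
  apply: filterS2 (filterI h1 h2) (filterI h3 h4) => z [e1 e2] [e3 e4] Kz.
  have {e1} := e1 Kz; rewrite e2// e3// e4// => e1.
  under eq_bigr do rewrite wave_jet_schroedinger// mulrDr mulrBr mulrN
    (mulrCA _ v%:C) (mulrCA _ 'i%C).
  rewrite big_split/= sumrB sumrN -!big_distrr/=.
  by apply/eqP; rewrite -subr_eq0 -[X in _ == X]e1; apply/eqP; ring.
- have nD s : (@leb3 R).-integrable K (EFin \o (fun z => normc (D s z))).
    exact: in_L1_normc.
  have nDB s : (@leb3 R).-integrable B (EFin \o (fun z => normc (D s z))).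
    exact: in_L1_normc.
  have nN0 s'' : 0 <= nN s'' by apply: sumr_ge0 => s _; rewrite normcE sqrtr_ge0.
  have normc0 (x : R[i]) : 0 <= normc x by rewrite normcE sqrtr_ge0.
  have normcS (I : Type) (t : seq I) (f : I -> R[i]) :
      normc (\sum_(i <- t) f i) <= \sum_(i <- t) normc (f i).
    elim: t => [|i t IH]; first by rewrite !big_nil normcE/= expr0n/= addr0 sqrtr0.
    by rewrite !big_cons (le_trans (le_normcD _ _))// lerD2l.
  have aE z : \sum_(m < p.+1) \sum_(l < (2 * m).+1) normc (a m l z) <=
      \sum_s'' nN s'' * normc (D s'' z).
    rewrite sig_big_dep/=.
    apply: (@le_trans _ _ (\sum_(s : W) \sum_s'' normc (N s s'') * normc (D s'' z))).
      apply: ler_sum => -[m l] _ /=; rewrite /a normcM normc_conj_wave mul1r.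
      by apply: le_trans (normcS _ _ _) _; apply: ler_sum => s'' _; rewrite normcM.
    by rewrite exchange_big/=; apply: ler_sum => s'' _; rewrite -big_distrl.
  have nNDi s'' : (@leb3 R).-integrable B (EFin \o (fun z => nN s'' * normc (D s'' z))).
    exact: (@integrableZl _ _ _ (@leb3 R) B mB _ _ (nDB s'')).
  have Ds s : \int[@leb3 R]_(z in B) normc (D s z) <=
      Num.sqrt (fine (@leb3 R K)) * sobolev_norm p.+1 K psi.
    apply: (le_trans (ge0_subset_Rintegral mB mK BK (nD s) (fun z _ => normc0 _))).
    have [L2 _] := weakDP sobolev_psi (ordW s).
    apply: (le_trans (cauchy_schwarz_cst mK Koo (nD s) (in_L2_sqr_integrable L2))).
    by rewrite ler_wpM2l ?sqrtr_ge0// le_sobolev_norm.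
  apply: (@le_trans _ _ (\int[@leb3 R]_(z in B) \sum_s'' nN s'' * normc (D s'' z))).
    apply: le_Rintegral => //; last exact: integrable_sumr.
    apply: integrable_sumr => // m; apply: integrable_sumr => // l.
    by apply: in_L1_normc => //; exact: in_L1_conj_wave.
  rewrite Rintegral_sum// -mulrA mulrDl mul1r.
  rewrite ler_wpDl ?mulr_ge0 ?sqrtr_ge0// big_distrl/=.
  by apply: ler_sum => s'' _; rewrite RintegralZl// ler_wpM2l.
Qed.
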